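(* Let $W_1,W_2\subset\mathbb{H}$ be two-dimensional vertical subgroups such that $W_1\neq W_2$. If $\lambda>0$ is sufficiently large (i.e., there is a $\lambda_0>0$ such that for every $\lambda>\lambda_0$), then there are $L,L'\in(0,1)$ such that: (1) If $\Gamma_1$ and $\Gamma_2$ are entire $L$-iLip graphs over $W_1$ and $W_2$ respectively, then $\Gamma_1\cap\Gamma_2$ is a $\lambda$-vertical curve which is nonempty, closed, connected, and has no endpoints. (2) If $E$ is a $\lambda$-vertical curve, then there are entire $L'$-iLip graphs $\Gamma_1$ and $\Gamma_2$ over $W_1$ and $W_2$ respectively such that $\Gamma_1\cap\Gamma_2$ is a vertical curve containing $E$. If $E$ is nonempty, closed, connected, and has no endpoints, then $\Gamma_1\cap\Gamma_2=E$.
   Context: $\mathbb{H}$ is the first Heisenberg group, identified with $\mathbb{R}^3$ with the group law $(x,y,z)(x',y',z')=\left(x+x',y+y',z+z'+\tfrac12(xy'-x'y)\right)$ and identity $\mathbf{0}$. The Kor\'anyi norm is $|(x,y,z)|_{\mathrm{Kor}}=\sqrt[4]{(x^2+y^2)^2+16z^2}$ and the distance is $d(a,b)=|b^{-1}a|_{\mathrm{Kor}}$; $d(p,W)=\inf_{w\in W}d(p,w)$. For $\lambda>0$, $\mathrm{VCone}_\lambda=\{(x,y,z)\in\mathbb{H}: |z|\ge\lambda(x^2+y^2)\}$. A set $E\subset\mathbb{H}$ is a $\lambda$-vertical curve if $E\subset p\,\mathrm{VCone}_\lambda$ for all $p\in E$; it is a vertical curve if it is a $\lambda$-vertical curve for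 some $\lambda>0$. Every connected vertical curve is homeomorphic to an interval; a nonempty connected vertical curve has no endpoints if it is homeomorphic to a nonempty open interval. A two-dimensional vertical subgroup is a set $W=\{(x,y,z): ax+by=0\}$ with $(a,b)\neq(0,0)$. For $L\in(0,1)$, $\mathrm{Cone}_{W,L}=\{p\in\mathbb{H}: d(p,W)\le L\,d(\mathbf{0},p)\}$. A set $E\subset\mathbb{H}$ is an $L$-iLip (intrinsic $L$-Lipschitz) graph over $W$ if $E\subset p\,\mathrm{Cone}_{W,L}$ for all $p\in E$. Let $W^\perp\subset\{z=0\}$ be the one-parameter horizontal subgroup orthogonal to $W$; then $\mathbb{H}=W\cdot W^\perp$, and $\Pi_W\colon\mathbb{H}\to W$ denotes the projection $\Pi_W(wv)=w$ for $w\in W$, $v\in W^\perp$. An $L$-iLip graph $E$ over $W$ is entire if $\Pi_W(E)=W$. *)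

(* Defs.v *)
From HB Require Import structures.
From mathcomp Require Import all_boot all_order all_algebra.
From mathcomp Require Import all_classical all_reals all_analysis.
From mathcomp Require Import ring.
Set Implicit Arguments.
Unset Strict Implicit.
Unset Printing Implicit Defensive.
Import Order.TTheory GRing.Theory Num.Theory.
Import numFieldNormedType.Exports.
Local Open Scope classical_set_scope.
Local Open Scope ring_scope.

(* The topology is the product topology of R^3; it coincides with the topology
   of the Koranyi metric. *)
Definition heis (R : realType) : Type := (R * R * R)%type.
HB.instance Definition _ (R : realType) :=
  Pointed.copy (heis R) (R * R * R)%type.
HB.instance Definition _ (R : realType) :=
  PseudoMetric.copy (heis R) (R * R * R)%type.

Section Heisenberg.
Context {R : realType}.
Implicit Types (p q : heis R) (E W : set (heis R)) (L lambda : R).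

Definition hx p : R := p.1.1.
Definition hy p : R := p.1.2.
Definition hz p : R := p.2.

Definition heis_mul p q : heis R :=
  (hx p + hx q, hy p + hy q,
   hz p + hz q + 2^-1 * (hx p * hy q - hx q * hy p)).
Definition heis_one : heis R := (0, 0, 0).
Definition heis_inv p : heis R := (- hx p, - hy p, - hz p).

Fact heis_mulA : associative heis_mul.
Proof.
move=> [[a b] c] [[a' b'] c'] [[a'' b''] c''].
by rewrite /heis_mul /heis_inv /heis_one /hx /hy /hz /=;
  congr (_, _, _); ring.
Qed.

Fact heis_mul1 : left_id heis_one heis_mul.
Proof.
move=> [[a b] c].
by rewrite /heis_mul /heis_inv /heis_one /hx /hy /hz /=;
  congr (_, _, _); ring.
Qed.

Fact heis_mulV : left_inverse heis_one heis_inv heis_mul.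
Proof.
move=> [[a b] c].
by rewrite /heis_mul /heis_inv /heis_one /hx /hy /hz /=;
  congr (_, _, _); ring.
Qed.

Fact heis_mul1r : right_id heis_one heis_mul.
Proof.
move=> [[a b] c].
by rewrite /heis_mul /heis_inv /heis_one /hx /hy /hz /=;
  congr (_, _, _); ring.
Qed.

Fact heis_mulVr : right_inverse heis_one heis_inv heis_mul.
Proof.
move=> [[a b] c].
by rewrite /heis_mul /heis_inv /heis_one /hx /hy /hz /=;
  congr (_, _, _); ring.
Qed.

HB.instance Definition _ := isGroup.Build (heis R)
  heis_mulA heis_mul1 heis_mul1r heis_mulV heis_mulVr.

Definition translate p E : set (heis R) := [set (p * q)%g | q in E].

Definition kor_norm p : R :=
  ((hx p ^+ 2 + hy p ^+ 2) ^+ 2 + 16 * hz p ^+ 2) `^ 4^-1.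
Definition kor_dist p q : R := kor_norm (q^-1 * p)%g.
Definition kor_dist_set p W : R := inf [set kor_dist p w | w in W].

Definition vcone lambda : set (heis R) :=
  [set p | lambda * (hx p ^+ 2 + hy p ^+ 2) <= `|hz p|].
Definition is_vertical_curve_at lambda E : Prop :=
  forall p, E p -> E `<=` translate p (vcone lambda).
Definition is_vertical_curve E : Prop :=
  exists2 lambda, 0 < lambda & is_vertical_curve_at lambda E.

Definition vertical_subgroup W : Prop :=
  exists a b : R, (a, b) != (0, 0) /\ W = [set p | a * hx p + b * hy p = 0].

Definition horizontal_perp W : set (heis R) :=
  [set v | hz v = 0 /\ forall w, W w -> hx v * hx w + hy v * hy w = 0].

(* [xget] makes the projection total; the lemmas [vproj_mul] and
   [vertical_subgroup_factor] show that for a vertical subgroup [W] the default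
   value is never used and the choice is unique. *)
Definition vproj W p : heis R :=
  xget 1%g [set w | W w /\ exists2 v, horizontal_perp W v & p = (w * v)%g].

Definition intrinsic_cone W L : set (heis R) :=
  [set p | kor_dist_set p W <= L * kor_dist 1%g p].
Definition iLip_graph W L E : Prop :=
  forall p, E p -> E `<=` translate p (intrinsic_cone W L).
Definition entire_iLip_graph W L E : Prop :=
  iLip_graph W L E /\ vproj W @` E = W.

Lemma horizontal_perpE (a b : R) : (a, b) != (0, 0) ->
  horizontal_perp [set p | a * hx p + b * hy p = 0] =
  [set v | exists t, v = (t * a, t * b, 0)].
Proof.
move=> ab0.
have N0 : a ^+ 2 + b ^+ 2 != 0.
  apply: contra ab0; rewrite paddr_eq0 ?sqr_ge0 // !sqrf_eq0.
  by move=> /andP[/eqP -> /eqP ->].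
apply/seteqP; split => [[[x y] z]|_ [t ->]]; last first.
  by split=> // w /= H; rewrite /hx /hy /= -!mulrA -mulrDr H mulr0.
rewrite /horizontal_perp /hx /hy /hz /= => -[-> /(_ (- b, a, 0)) /=].
have -> : a * - b + b * a = 0 by ring.
move=> /(_ erefl) xy0; exists ((a * x + b * y) / (a ^+ 2 + b ^+ 2)).
congr (_, _, _); apply: (mulIf N0); rewrite mulrAC divfK //; apply/eqP.
  rewrite -subr_eq0; have -> : x * (a ^+ 2 + b ^+ 2) - (a * x + b * y) * a =
    - b * (x * - b + y * a) by ring.
  by rewrite xy0 mulr0.
rewrite -subr_eq0; have -> : y * (a ^+ 2 + b ^+ 2) - (a * x + b * y) * b =
  a * (x * - b + y * a) by ring.
by rewrite xy0 mulr0.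
Qed.

Lemma vertical_subgroup_factor W p : vertical_subgroup W ->
  exists w v, [/\ W w, horizontal_perp W v & p = (w * v)%g].
Proof.
move=> [a [b [ab0 ->]]]; rewrite horizontal_perpE //.
have N0 : a ^+ 2 + b ^+ 2 != 0.
  apply: contra ab0; rewrite paddr_eq0 ?sqr_ge0 // !sqrf_eq0.
  by move=> /andP[/eqP -> /eqP ->].
pose t := (a * hx p + b * hy p) / (a ^+ 2 + b ^+ 2).
pose v : heis R := (t * a, t * b, 0).
exists (p / v)%g, v; split; last by rewrite mulgVK.
  rewrite /= -[(p / v)%g]/(heis_mul p (heis_inv v)) /heis_mul /heis_inv /v /t.
  by rewrite /hx /hy /=; field.
by exists t.
Qed.

Lemma vproj_mul W w v : vertical_subgroup W -> W w -> horizontal_perp W v ->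
  vproj W (w * v)%g = w.
Proof.
move=> WV Ww Wv; apply: xget_unique; first by split => //; exists v.
case: WV Ww Wv => a [b [ab0 ->]] /=; rewrite horizontal_perpE //.
have N0 : a ^+ 2 + b ^+ 2 != 0.
  apply: contra ab0; rewrite paddr_eq0 ?sqr_ge0 // !sqrf_eq0.
  by move=> /andP[/eqP -> /eqP ->].
move=> Ww [t ->] w' [Ww' [_ [s ->] E]].
suff st : s = t.
  by rewrite -[w in RHS](mulgK ((t * a, t * b, 0) : heis R)) E st mulgK.
move: E Ww Ww'; case: w => [[x y] z]; case: w' => [[x' y'] z'].
rewrite /hx /hy /= => -[/= + + _]; rewrite /hx /hy /= => Ex Ey W0 W0'.
apply: (mulIf N0).
have : a * (x + t * a) + b * (y + t * b) = a * (x' + s * a) + b * (y' + s * b).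
  by rewrite Ex Ey.
have -> : a * (x + t * a) + b * (y + t * b) =
  (a * x + b * y) + t * (a ^+ 2 + b ^+ 2) by ring.
have -> : a * (x' + s * a) + b * (y' + s * b) =
  (a * x' + b * y') + s * (a ^+ 2 + b ^+ 2) by ring.
by rewrite W0 W0' !add0r.
Qed.

End Heisenberg.

Definition homeomorphic_sets (S T : topologicalType) (A : set S) (B : set T)
  : Prop :=
  exists (f : S -> T) (g : T -> S),
    [/\ {within A, continuous f}, {within B, continuous g},
        f @` A `<=` B /\ g @` B `<=` A,
        forall x, A x -> g (f x) = x & forall y, B y -> f (g y) = y].

Definition has_no_endpoints (R : realType) (E : set (heis R)) : Prop :=
  exists I : set R,
    [/\ I !=set0, open I, is_interval I & homeomorphic_sets I E].

(* Main.v *)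
Require Import Defs.
From mathcomp Require Import all_boot all_order all_algebra.
From mathcomp Require Import all_classical all_reals all_analysis.
From mathcomp Require Import ring lra.
Set Implicit Arguments.
Unset Strict Implicit.
Unset Printing Implicit Defensive.
Import Order.TTheory GRing.Theory Num.Theory.
Import numFieldNormedType.Exports.
Local Open Scope classical_set_scope.
Local Open Scope ring_scope.
(** Intrinsic Lipschitz graphs are level sets of Lipschitz functions.  For
a unit vector (a, b) and W = {ax + by = 0}, the distance from p to W is
|ax + by|, so the cone condition says exactly that the linear form
t = ax + by is L-Lipschitz on the graph for the Koranyi distance d.  By
McShane's extension t agrees on the graph with an L-Lipschitz function g on
the whole group, and since L < 1 every horizontal line orthogonal to W meets
{t = g} exactly once.  Hence the entire L-Lipschitz graphs over W are
precisely the sets {t = g}, and every set on which t is L-Lipschitz lies on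
one of them ([lin_graph_entire], [entire_graph_lin], [mcshane_extension]).

Given two distinct planes, solving the two linear equations turns the
intersection of {t1 = g1} and {t2 = g2} into a set F = {(x, y) = g(p)}, where
g, from the group to R^2, is kappa-Lipschitz with kappa = 2L/|D| and D the
determinant of the two unit normals ([lin_graph_intersection]).  For small
kappa all geometric properties of F follow from this form:
- two points of F differ horizontally by at most kappa times their distance,
  so they are in vertical position ([fixed_set_vertical]);
- moving a point p horizontally by g(p) - (x, y) shrinks this residual by the
  factor kappa, so F has points at a distance from p controlled by the
  residual ([fixed_set_near]); applied to the point lying at height t over a
  point of F, this gives points of F in all relative heights up to a bounded
  factor ([fixed_set_no_gaps]).

A closed set F of this kind is a line.  The relative height z(p^-1 q) is
superadditive on F up to the factor 3/4, because the area term in the group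
law is dominated by heights; it therefore defines a total order, in which
points between p and r have distance at most 2 d(p, r) from both.  The
relative height itself is not monotone, so an increasing Lipschitz function
[height] is built as a weighted sum of running suprema of countably many
bumps.  Absence of gaps and compactness of order segments make its image an
open interval and its inverse continuous ([no_gaps_has_no_endpoints],
[no_gaps_connected]).

For the converse, a lambda-vertical curve with 1 < 4 lambda L'^2 makes both
linear forms L'-Lipschitz ([vertical_curve_lipschitz]), hence lies on two
entire graphs.  If it is closed, connected and without endpoints, it exhausts
their intersection F: otherwise it would lie on one side of a point p of F,
hence contain a point closest to p in the order, and a point of an open arc
cannot be extremal for an injective continuous function
([no_endpoints_maximal]). *)

(** * The Koranyi distance and relative heights *)
Section KoranyiMetric.
Context {R : realType}.
Implicit Types (p q r w : heis R) (E F W : set (heis R)).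

(** The height of [q] seen from [p]; the group law makes it differ from
[hz q - hz p] by the area of a triangle. *)
Definition zrel p q : R := hz (p^-1 * q)%g.

Lemma hx_mul p q : hx (p * q)%g = hx p + hx q. Proof. by []. Qed.
Lemma hy_mul p q : hy (p * q)%g = hy p + hy q. Proof. by []. Qed.
Lemma hz_mul p q :
  hz (p * q)%g = hz p + hz q + 2^-1 * (hx p * hy q - hx q * hy p).
Proof. by []. Qed.
Lemma hx_inv p : hx (p^-1)%g = - hx p. Proof. by []. Qed.
Lemma hy_inv p : hy (p^-1)%g = - hy p. Proof. by []. Qed.
Lemma hz_inv p : hz (p^-1)%g = - hz p. Proof. by []. Qed.
Definition heisE := (hx_mul, hy_mul, hz_mul, hx_inv, hy_inv, hz_inv).

Lemma heis_eq p q : hx p = hx q -> hy p = hy q -> hz p = hz q -> p = q.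
Proof.
by case: p q => [[a b] c] [[a' b'] c']; rewrite /hx /hy /hz /= => -> -> ->. Qed.

Lemma ler_of_pow n (x y : R) : 0 <= y -> x ^+ n.+1 <= y ^+ n.+1 -> x <= y.
Proof.
move=> y0; case: (lerP 0 x) => x0; first by rewrite ler_pXn2r.
by move=> _; apply: le_trans y0; apply: ltW.
Qed.

Lemma cauchy_schwarz2 (a b u v c : R) : 0 <= c ->
  (a ^+ 2 + b ^+ 2) * (u ^+ 2 + v ^+ 2) <= c ^+ 2 -> a * u + b * v <= c.
Proof.
move=> c0 H; apply: (@ler_of_pow 1) => //; apply: le_trans H.
rewrite -subr_ge0 (_ : _ - _ = (a * v - b * u) ^+ 2) ?sqr_ge0 //; ring.
Qed.

Lemma kor_norm_ge0 p : 0 <= kor_norm p.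
Proof. exact: powR_ge0. Qed.

Lemma kor_norm4 p :
  kor_norm p ^+ 4 = (hx p ^+ 2 + hy p ^+ 2) ^+ 2 + 16 * hz p ^+ 2.
Proof.
have H : 0 <= (hx p ^+ 2 + hy p ^+ 2) ^+ 2 + 16 * hz p ^+ 2.
  by rewrite addr_ge0 ?sqr_ge0 // mulr_ge0 // sqr_ge0.
rewrite -powR_mulrn ?kor_norm_ge0 // /kor_norm -powRrM.
by rewrite mulVf ?powRr1 // pnatr_eq0.
Qed.

Lemma kor_norm_inv p : kor_norm (p^-1)%g = kor_norm p.
Proof. by rewrite /kor_norm !heisE !sqrrN. Qed.

Lemma kor_norm_horizontal p : hx p ^+ 2 + hy p ^+ 2 <= kor_norm p ^+ 2.
Proof.
apply: (@ler_of_pow 1); first exact: sqr_ge0.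
by rewrite -exprM kor_norm4; have := sqr_ge0 (hz p); lra.
Qed.

Lemma kor_norm_vertical p : 4 * `|hz p| <= kor_norm p ^+ 2.
Proof.
apply: (@ler_of_pow 1); first exact: sqr_ge0.
rewrite -exprM kor_norm4 exprMn -[`|_| ^+ 2]normrX ger0_norm ?sqr_ge0 //.
by have := sqr_ge0 (hx p ^+ 2 + hy p ^+ 2); lra.
Qed.

(** The fourth power of the norm is the squared modulus of the complex number
[r^2 + 4iz].  For a product this number is the sum of those of the factors
and of twice a number of modulus [r r'], whence the triangle inequality. *)
Lemma kor_normM p q : kor_norm (p * q)%g <= kor_norm p + kor_norm q.
Proof.
have P0 := kor_norm_ge0 p; have Q0 := kor_norm_ge0 q.
apply: (@ler_of_pow 3); first exact: addr_ge0.
rewrite kor_norm4 !heisE; have := kor_norm4 p; have := kor_norm4 q.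
have := kor_norm_horizontal p; have := kor_norm_horizontal q.
move: P0 Q0; move: (kor_norm p) (kor_norm q) => P Q.
move: (hx p) (hy p) (hz p) (hx q) (hy q) (hz q) => x y z x' y' z'.
move=> P0 Q0 HB HA EB EA.
pose A := x ^+ 2 + y ^+ 2; pose B := x' ^+ 2 + y' ^+ 2.
pose u := x * x' + y * y'; pose v := x * y' - x' * y.
have A0 : 0 <= A by rewrite addr_ge0 ?sqr_ge0.
have B0 : 0 <= B by rewrite addr_ge0 ?sqr_ge0.
have uv : u ^+ 2 + v ^+ 2 = A * B by rewrite /u /v /A /B; ring.
have AB : A * B <= (P * Q) ^+ 2 by rewrite exprMn ler_pM.
have bb : A * B + (4 * z) * (4 * z') <= (P * Q) ^+ 2.
  apply: cauchy_schwarz2; first exact: sqr_ge0.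
  rewrite (_ : A ^+ 2 + _ = P ^+ 4); last by rewrite EA /A; ring.
  rewrite (_ : B ^+ 2 + _ = Q ^+ 4); last by rewrite EB /B; ring.
  by rewrite -exprMn -exprM.
have Pu : A * u + (4 * z) * v <= P ^+ 2 * (P * Q).
  apply: cauchy_schwarz2; first by rewrite !mulr_ge0 ?sqr_ge0.
  rewrite (_ : A ^+ 2 + _ = P ^+ 4); last by rewrite EA /A; ring.
  by rewrite uv exprMn -exprM ler_wpM2l // exprn_ge0.
have Qu : B * u + (4 * z') * v <= Q ^+ 2 * (P * Q).
  apply: cauchy_schwarz2; first by rewrite !mulr_ge0 ?sqr_ge0.
  rewrite (_ : B ^+ 2 + _ = Q ^+ 4); last by rewrite EB /B; ring.
  by rewrite uv exprMn -exprM ler_wpM2l // exprn_ge0.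
(* [u] and [v] are the scalar product and the area of the two horizontal parts:
   the complex numbers above are A + 4iz, B + 4iz' and u + iv. *)
rewrite [X in X <= _](_ : _ = (A + B + 2 * u) ^+ 2 + (4 * z + 4 * z' + 2 * v)
  ^+ 2);
  last by rewrite /A /B /u /v; field.
rewrite [X in X <= _](_ : _ = P ^+ 4 + Q ^+ 4 + 4 * (A * B) +
    2 * (A * B + (4 * z) * (4 * z')) + 4 * (A * u + 4 * z * v) +
    4 * (B * u + 4 * z' * v)); last by rewrite -uv EA EB /A /B /u /v; ring.
rewrite (_ : (P + Q) ^+ 4 = P ^+ 4 + Q ^+ 4 + 4 * (P * Q) ^+ 2 +
  2 * (P * Q) ^+ 2 + 4 * (P ^+ 2 * (P * Q)) + 4 * (Q ^+ 2 * (P * Q)));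
    last ring.
lra.
Qed.

Lemma kor_dist_ge0 p q : 0 <= kor_dist p q.
Proof. exact: kor_norm_ge0. Qed.

Lemma kor_dist_sym p q : kor_dist p q = kor_dist q p.
Proof. by rewrite /kor_dist -kor_norm_inv invgM invgK. Qed.

Lemma kor_distV p q : kor_dist p q = kor_norm (p^-1 * q)%g.
Proof. by rewrite kor_dist_sym. Qed.

Lemma kor_dist_triangle q p r : kor_dist p r <= kor_dist p q + kor_dist q r.
Proof.
rewrite addrC /kor_dist (_ : r^-1 * p = (r^-1 * q) * (q^-1 * p))%g.
  exact: kor_normM.
by rewrite mulgA mulgK.
Qed.

Lemma kor_dist_mulr p q : kor_dist p (p * q)%g = kor_norm q.
Proof. by rewrite kor_distV mulKg. Qed.

Lemma kor_dist_horizontal p q :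
  (hx q - hx p) ^+ 2 + (hy q - hy p) ^+ 2 <= kor_dist p q ^+ 2.
Proof.
apply: le_trans (kor_norm_horizontal _); rewrite !heisE; lra.
Qed.

Lemma kor_dist_vertical p q : 4 * `|zrel p q| <= kor_dist p q ^+ 2.
Proof. by rewrite kor_distV; exact: kor_norm_vertical. Qed.

Lemma kor_dist4 p q : kor_dist p q ^+ 4 =
  ((hx q - hx p) ^+ 2 + (hy q - hy p) ^+ 2) ^+ 2 + 16 * zrel p q ^+ 2.
Proof. by rewrite kor_distV kor_norm4 /zrel !heisE; ring. Qed.

Lemma zrelE p q :
  zrel p q = hz q - hz p - 2^-1 * (hx p * hy q - hx q * hy p).
Proof. by rewrite /zrel !heisE; ring. Qed.

Lemma zrel_refl p : zrel p p = 0.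
Proof. by rewrite zrelE; lra. Qed.

Lemma zrelC p q : zrel q p = - zrel p q.
Proof. by rewrite !zrelE; ring. Qed.

(** Relative heights are additive up to the area of the horizontal triangle. *)
Lemma zrelD q p r : zrel p r = zrel p q + zrel q r +
  2^-1 * ((hx q - hx p) * (hy r - hy q) - (hx r - hx q) * (hy q - hy p)).
Proof. by rewrite !zrelE; ring. Qed.

Lemma kor_dist_eq0 p q : kor_dist p q = 0 -> p = q.
Proof.
move=> d0; have := kor_dist_horizontal p q; have := kor_dist_vertical p q.
rewrite d0 expr0n /= => zle hle.
have z0 : zrel p q = 0 by apply/eqP; rewrite -normr_eq0;
  have := normr_ge0 (zrel p q); lra.
have := sqr_ge0 (hx q - hx p); have := sqr_ge0 (hy q - hy p) => y2 x2.
have /eqP : (hx q - hx p) ^+ 2 = 0 by lra.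
have /eqP : (hy q - hy p) ^+ 2 = 0 by lra.
rewrite !sqrf_eq0 !subr_eq0 => /eqP ey /eqP ex.
by apply: heis_eq => //; move: z0; rewrite zrelE ex ey; lra.
Qed.

Lemma kor_dist_gt0 p q : p <> q -> 0 < kor_dist p q.
Proof.
by move=> pq; rewrite lt0r kor_dist_ge0 andbT; apply/eqP => /kor_dist_eq0.
Qed.

Lemma kor_dist_refl p : kor_dist p p = 0.
Proof.
have : kor_dist p p ^+ 4 = 0 by rewrite kor_dist4 zrelE !subrr; ring.
by move=> /eqP; rewrite expf_eq0 => /eqP.
Qed.

End KoranyiMetric.

(** * The Koranyi distance induces the topology of R^3 *)
Section KoranyiTopology.
Context {R : realType}.
Implicit Types (p q r w : heis R) (E F W : set (heis R)).

Lemma hx_continuous : continuous (@hx R).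
Proof. move=> p; apply: (@cvg_comp _ _ _ fst fst); exact: cvg_fst. Qed.

Lemma hy_continuous : continuous (@hy R).
Proof. move=> p; apply: (@cvg_comp _ _ _ fst snd);
  [exact: cvg_fst|exact: cvg_snd]. Qed.

Lemma hz_continuous : continuous (@hz R).
Proof. move=> p; exact: cvg_snd. Qed.

Lemma zrel_continuous p : continuous (zrel p).
Proof.
rewrite (_ : zrel p = fun q => hz q - hz p - 2^-1 * (hx p * hy q - hx q * hy
  p));
  last by apply/funext => q; exact: zrelE.
move=> q; have X := @hx_continuous q; have Y := @hy_continuous q.
have Z := @hz_continuous q.
apply: cvgB; first by apply: cvgB => //; exact: cvg_cst.
apply: cvgM; first exact: cvg_cst.
by apply: cvgB; apply: cvgM => //; exact: cvg_cst.
Qed.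

Lemma kor_dist4_continuous p : continuous (fun q => kor_dist p q ^+ 4).
Proof.
rewrite (_ : (fun q => _) = fun q => ((hx q - hx p) ^+ 2 + (hy q - hy p) ^+ 2)
  ^+ 2
   + 16 * zrel p q ^+ 2); last by apply/funext => q; exact: kor_dist4.
move=> q; have X := @hx_continuous q; have Y := @hy_continuous q.
have Z := @zrel_continuous p q.
have sqr (f : heis R -> R) (l : R) : f x @[x --> q] --> l ->
    f x ^+ 2 @[x --> q] --> l ^+ 2.
  by move=> fl; rewrite expr2; under eq_cvg do rewrite expr2; exact: cvgM.
apply: cvgD; last first.
  apply: cvgM; first exact: cvg_cst.
  by apply: (sqr (zrel p)).
apply: (sqr (fun q => (hx q - hx p) ^+ 2 + (hy q - hy p) ^+ 2)).
apply: cvgD; [apply: (sqr (fun q => hx q - hx p))|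
  apply: (sqr (fun q => hy q - hy p))]; apply: cvgB => //; exact: cvg_cst.
Qed.

Lemma kor_ball_nbhs p e : 0 < e -> nbhs p [set q | kor_dist p q < e].
Proof.
move=> e0; have C := @kor_dist4_continuous p p.
have : nbhs (kor_dist p p ^+ 4) [set x | x < e ^+ 4].
  apply: open_nbhs_nbhs; split; first exact: open_lt.
  by rewrite /= kor_dist_refl expr0n /= exprn_gt0.
move=> /C; apply: (@filterS _ (nbhs p)) => q /=.
by rewrite ltr_pXn2r // ?nnegrE ?kor_dist_ge0 // ltW.
Qed.

Lemma kor_dist_hx p q : `|hx q - hx p| <= kor_dist p q.
Proof.
apply: (@ler_of_pow _ 1); first exact: kor_dist_ge0.
apply: le_trans (kor_dist_horizontal p q).
by rewrite real_normK ?num_real // lerDl sqr_ge0.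
Qed.

Lemma kor_dist_hy p q : `|hy q - hy p| <= kor_dist p q.
Proof.
apply: (@ler_of_pow _ 1); first exact: kor_dist_ge0.
apply: le_trans (kor_dist_horizontal p q).
by rewrite real_normK ?num_real // lerDr sqr_ge0.
Qed.

(** The area term makes heights only locally Lipschitz: its constant grows with
the horizontal position of the centre. *)
Lemma kor_dist_hz p q : `|hz q - hz p| <=
  kor_dist p q ^+ 2 + (`|hx p| + `|hy p|) * kor_dist p q.
Proof.
have := kor_dist_vertical p q; have := kor_dist_hx p q; have := kor_dist_hy p q.
rewrite (_ : hz q - hz p = zrel p q +
  2^-1 * (hx p * (hy q - hy p) - (hx q - hx p) * hy p)); last first.
  by rewrite zrelE; ring.
move: (hy q - hy p) (hx q - hx p) (zrel p q) => v u z hv hu hz.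
have uy : `|u * hy p| <= kor_dist p q * `|hy p|.
  by rewrite normrM ler_wpM2r.
have xv : `|hx p * v| <= `|hx p| * kor_dist p q.
  by rewrite normrM ler_wpM2l.
have D := ler_normB (hx p * v) (u * hy p).
have T := ler_normD z (2^-1 * (hx p * v - u * hy p)).
rewrite normrM [`|2^-1|]ger0_norm ?invr_ge0 // in T.
have d2 := sqr_ge0 (kor_dist p q); have := normr_ge0 z.
have := normr_ge0 (u * hy p); have := normr_ge0 (hx p * v); lra.
Qed.

Lemma nbhs_kor_ball p (U : set (heis R)) : nbhs p U ->
  exists2 e, 0 < e & forall q, kor_dist p q < e -> U q.
Proof.
move=> /nbhs_ballP[e /= e0 eU].
pose c := 2 + `|hx p| + `|hy p|.
have c2 : 2 <= c by rewrite /c -addrA lerDl addr_ge0.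
have c0 : 0 < c by lra.
exists (Num.min 1 (e / c)); first by rewrite lt_min ltr01 divr_gt0.
move=> q; rewrite lt_min ltr_pdivlMr // => /andP[d1 de]; apply: eU.
have d0 := kor_dist_ge0 p q.
have dle : kor_dist p q <= kor_dist p q * c by rewrite ler_peMr //; lra.
have zle : `|hz q - hz p| <= kor_dist p q * c.
  apply: le_trans (kor_dist_hz p q) _.
  have : kor_dist p q ^+ 2 <= kor_dist p q by rewrite expr2 ler_piMr // ltW.
  by rewrite /c; lra.
have := kor_dist_hx p q; have := kor_dist_hy p q.
rewrite (distrC (hx q)) (distrC (hy q)) => yle xle; rewrite distrC in zle.
by split; first split; rewrite /ball /=; apply: le_lt_trans de => //;
   apply: le_trans dle.
Qed.

Lemma kor_lipschitz_continuous F (f : heis R -> R) C :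
  (forall p q, F p -> F q -> f q <= f p + C * kor_dist p q) ->
  {within F, continuous f}.
Proof.
move=> fC; apply/subspace_continuousP => p Fp; apply/cvgrPdist_lt => e e0.
pose c := `|C| + 1; have c0 : 0 < c by rewrite ltr_wpDl.
have := kor_ball_nbhs p (divr_gt0 e0 c0); apply: (@filterS _ (nbhs p)) => q /=
  dq Fq.
rewrite ltr_pdivlMr // in dq; have := fC _ _ Fp Fq; have := fC _ _ Fq Fp.
rewrite kor_dist_sym => H1 H2.
have : C * kor_dist p q <= `|C| * kor_dist p q.
  by rewrite ler_wpM2r ?kor_dist_ge0 ?ler_norm.
have := kor_dist_ge0 p q; rewrite ltr_norml /from_subspace;
  rewrite /c in dq => d0 Cd.
by apply/andP; split; lra.
Qed.

Lemma kor_bounded_compact F p M : closed F ->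
  (forall q, F q -> kor_dist p q <= M) -> compact F.
Proof.
move=> clF FM.
pose B := M ^+ 2 + (`|hx p| + `|hy p|) * M.
pose K := (`[hx p - M, hx p + M] `*` `[hy p - M, hy p + M]) `*`
          `[hz p - B, hz p + B].
have cK : compact K.
  by apply: compact_setX; [apply: compact_setX|]; exact: segment_compact.
apply: (subclosed_compact clF cK) => q Fq; have dM := FM _ Fq.
have := kor_dist_hx p q; have := kor_dist_hy p q; have := kor_dist_hz p q.
have d0 := kor_dist_ge0 p q.
have M2 : kor_dist p q ^+ 2 <= M ^+ 2.
  by rewrite ler_pXn2r // nnegrE //; exact: le_trans dM.
have M1 : (`|hx p| + `|hy p|) * kor_dist p q <= (`|hx p| + `|hy p|) * M.
  by rewrite ler_wpM2l // addr_ge0.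
rewrite !ler_norml => /andP[z1 z2] /andP[y1 y2] /andP[x1 x2].
rewrite -/(hx q) -/(hy q) -/(hz q) in x1 x2 y1 y2 z1 z2.
split; first split; rewrite /= in_itv /= -/(hx q) -/(hy q) -/(hz q) /B;
  apply/andP; split; lra.
Qed.

Lemma kor_rat_dense p e : 0 < e ->
  exists x : rat * rat * rat,
    kor_dist ((ratr x.1.1, ratr x.1.2, ratr x.2) : heis R) p < e.
Proof.
move=> e0; have /nbhs_ballP[d /= d0 dU] := kor_ball_nbhs p e0.
have approx (t : R) : exists x : rat, `|t - ratr x| < d.
  have [x] := @rat_in_itvoo R (t - d) (t + d) ltac:(lra).
  by rewrite in_itv /= => /andP[? ?]; exists x; rewrite ltr_norml; lra.
have [x xd] := approx (hx p); have [y yd] := approx (hy p).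
have [z zd] := approx (hz p); exists (x, y, z).
by rewrite kor_dist_sym; apply: dU.
Qed.

End KoranyiTopology.

(** * An increasing function on a vertical curve *)
Section HeightFunction.
Context {R : realType}.
Implicit Types (p q r e x : heis R) (E F : set (heis R)).

(** The condition [is_vertical_curve_at 1], in coordinates.  Any constant that
makes the area term small against heights would do for the order below. *)
Definition one_vertical F := forall p q, F p -> F q ->
  (hx q - hx p) ^+ 2 + (hy q - hy p) ^+ 2 <= `|zrel p q|.

Lemma zrel_inj F p q : one_vertical F -> F p -> F q -> zrel p q = 0 -> p = q.
Proof.
move=> vF Fp Fq z0; apply: kor_dist_eq0.
have := vF _ _ Fp Fq; rewrite z0 normr0 => h0.
have : kor_dist p q ^+ 4 = 0.
  have /eqP : (hx q - hx p) ^+ 2 + (hy q - hy p) ^+ 2 = 0.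
    by apply/eqP; rewrite eq_le h0 addr_ge0 ?sqr_ge0.
  by rewrite kor_dist4 z0 => /eqP ->; ring.
by move=> /eqP; rewrite expf_eq0 => /eqP.
Qed.

(** The area of the triangle is at most half the product of its sides, hence,
by the arithmetic-geometric inequality and verticality, a quarter of the sum
of the two relative heights. *)
Lemma zrel_superadditive F p q r : one_vertical F -> F p -> F q -> F r ->
  0 <= zrel p q -> 0 <= zrel q r ->
  3 / 4 * (zrel p q + zrel q r) <= zrel p r.
Proof.
move=> vF Fp Fq Fr pq qr; have := vF _ _ Fp Fq; have := vF _ _ Fq Fr.
rewrite (zrelD q p r) !ger0_norm //.
move: (hx q - hx p) (hy q - hy p) (hx r - hx q) (hy r - hy q) => a b c d H1 H2.
have := sqr_ge0 (a + d); have := sqr_ge0 (b - c).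
by rewrite !sqrrD !mulrN !sqrrN; lra.
Qed.

Lemma zrel_trans F p q r : one_vertical F -> F p -> F q -> F r ->
  0 <= zrel p q -> 0 <= zrel q r -> 0 <= zrel p r.
Proof.
by move=> vF Fp Fq Fr pq qr; have := zrel_superadditive vF Fp Fq Fr pq qr; lra.
Qed.

(** On a vertical set the distance is comparable to the square root of the
relative height, so near-monotonicity passes from heights to distances. *)
Lemma kor_dist_between F p q r : one_vertical F -> F p -> F q -> F r ->
  0 <= zrel p q -> 0 <= zrel q r ->
  kor_dist p q <= 2 * kor_dist p r /\ kor_dist q r <= 2 * kor_dist p r.
Proof.
move=> vF Fp Fq Fr pq qr; have H := zrel_superadditive vF Fp Fq Fr pq qr.
have D := kor_dist_vertical p r; rewrite ger0_norm in D; last by lra.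
(* d(s,t)^4 <= 17 z(s,t)^2 <= 17 (4/3)^2 z(p,r)^2 <= (17/9) d(p,r)^4. *)
have key s t : F s -> F t -> 0 <= zrel s t -> zrel s t <= 4 / 3 * zrel p r ->
    kor_dist s t <= 2 * kor_dist p r.
  move=> Fs Ft st stle; apply: (@ler_of_pow _ 3).
    by rewrite mulr_ge0 ?kor_dist_ge0.
  rewrite kor_dist4; have := vF _ _ Fs Ft; rewrite ger0_norm // => h.
  have h0 : 0 <= (hx t - hx s) ^+ 2 + (hy t - hy s) ^+ 2.
    by rewrite addr_ge0 ?sqr_ge0.
  have h2 : ((hx t - hx s) ^+ 2 + (hy t - hy s) ^+ 2) ^+ 2 <= zrel s t ^+ 2.
    by rewrite ler_pXn2r ?nnegrE.
  have : zrel s t ^+ 2 <= (kor_dist p r ^+ 2 / 3) ^+ 2.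
    by rewrite ler_pXn2r ?nnegrE //; [lra|rewrite divr_ge0 ?sqr_ge0].
  have -> : (kor_dist p r ^+ 2 / 3) ^+ 2 = kor_dist p r ^+ 4 / 9 by field.
  have := exprn_ge0 4 (kor_dist_ge0 p r).
  have -> : (2 * kor_dist p r) ^+ 4 = 16 * kor_dist p r ^+ 4 by ring.
  by lra.
by split; apply: key => //; lra.
Qed.

(** A dense sequence; indices that encode no triple are sent to the origin. *)
Definition rat_point n : heis R :=
  if @unpickle (rat * rat * rat)%type n is Some x
  then (ratr x.1.1, ratr x.1.2, ratr x.2) else 1%g.

Definition bump x p : R := Num.max 0 (1 - kor_dist x p).

(** The running supremum of [bump x] along the order of [F] up to [p]:
non-decreasing by construction. *)
Definition past_bump F x p : R :=
  sup [set bump x e | e in [set e | F e /\ 0 <= zrel e p]].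

Definition height_sum F p N : R :=
  \sum_(n < N) 2^-1 ^+ n * past_bump F (rat_point n) p.

(** A single running supremum need not increase strictly; the sum over a dense
family of centres does.  The partial sums increase
and are uniformly Lipschitz, so their supremum needs no convergence
argument. *)
Definition height F p : R := sup (range (height_sum F p)).

Lemma bump_ge0 x p : 0 <= bump x p.
Proof. by rewrite /bump le_max lexx. Qed.

Lemma bump_le1 x p : bump x p <= 1.
Proof. by rewrite /bump ge_max ler01 lerBlDr lerDl kor_dist_ge0. Qed.

Lemma bump_lip x p q : bump x p <= bump x q + kor_dist p q.
Proof.
rewrite {1}/bump ge_max addr_ge0 ?bump_ge0 ?kor_dist_ge0 //=.
have : 1 - kor_dist x q <= bump x q by rewrite /bump le_max lexx orbT.
by have := kor_dist_triangle p x q; lra.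
Qed.

Lemma past_bump_ub F x p e :
  F e -> 0 <= zrel e p -> bump x e <= past_bump F x p.
Proof.
move=> Fe ep; apply: ub_le_sup; last by exists e.
by exists 1 => _ [e' _ <-]; exact: bump_le1.
Qed.

Lemma past_bump_le F x p b : F p ->
  (forall e, F e -> 0 <= zrel e p -> bump x e <= b) -> past_bump F x p <= b.
Proof.
move=> Fp H; apply: ge_sup; last by move=> _ [e [Fe ep] <-]; exact: H.
by exists (bump x p), p => //; split => //; rewrite zrel_refl.
Qed.

Lemma past_bump_ge0 F x p : F p -> 0 <= past_bump F x p.
Proof.
by move=> Fp; apply: le_trans (bump_ge0 x p) (past_bump_ub _ Fp _);
  rewrite zrel_refl.
Qed.

Lemma past_bump_mono F x p q : one_vertical F -> F p -> F q -> 0 <= zrel p q ->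
  past_bump F x p <= past_bump F x q.
Proof.
move=> vF Fp Fq pq; apply: past_bump_le => // e Fe ep;
  apply: past_bump_ub => //.
exact: (zrel_trans vF Fe Fp Fq).
Qed.

(** Only points between [p] and [q] can increase the supremum, and these are
within [2 * kor_dist p q] of [p]. *)
Lemma past_bump_lip F x p q : one_vertical F -> F p -> F q ->
  past_bump F x q <= past_bump F x p + 2 * kor_dist p q.
Proof.
move=> vF Fp Fq; have d0 := kor_dist_ge0 p q.
apply: past_bump_le => // e Fe eq.
have [ep|pe] := lerP 0 (zrel e p).
  by have := past_bump_ub x Fe ep; lra.
have {}pe : 0 <= zrel p e by rewrite zrelC; lra.
have [H _] := kor_dist_between vF Fp Fe Fq pe eq.
have := past_bump_ub x Fp (eq_ind_r (fun t => 0 <= t) (lexx _) (zrel_refl p)).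
by have := bump_lip x e p; rewrite kor_dist_sym; lra.
Qed.

Lemma geometric_half_le N : \sum_(n < N) 2^-1 ^+ n <= 2 :> R.
Proof.
suff -> : \sum_(n < N) 2^-1 ^+ n = 2 - 2 * 2^-1 ^+ N :> R.
  by rewrite lerBlDr lerDl mulr_ge0 // exprn_ge0 // invr_ge0.
elim: N => [|N IH]; first by rewrite big_ord0 expr0; lra.
by rewrite big_ord_recr /= IH exprS; lra.
Qed.

Lemma height_sum_lip F p q N : one_vertical F -> F p -> F q ->
  height_sum F q N <= height_sum F p N + 4 * kor_dist p q.
Proof.
move=> vF Fp Fq; have d0 := kor_dist_ge0 p q.
apply: (@le_trans _ _ (\sum_(n < N) (2^-1 ^+ n * past_bump F (rat_point n) p +
   2^-1 ^+ n * (2 * kor_dist p q)))).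
  apply: ler_sum => n _; rewrite -mulrDr ler_wpM2l ?exprn_ge0 ?invr_ge0 //.
  exact: past_bump_lip.
rewrite big_split /= lerD2l -mulr_suml (_ : 4 * _ = 2 * (2 * kor_dist p q)).
  by rewrite ler_wpM2r ?geometric_half_le // mulr_ge0.
by ring.
Qed.

Lemma height_ub F p N : F p -> height_sum F p N <= height F p.
Proof.
move=> Fp; apply: ub_le_sup; last by exists N.
exists 2 => _ [M _ <-]; apply: le_trans (geometric_half_le M).
apply: ler_sum => n _; rewrite -[leRHS]mulr1 ler_wpM2l ?exprn_ge0 ?invr_ge0 //.
by apply: past_bump_le => // e _ _; exact: bump_le1.
Qed.

Lemma height_le F p b : (forall N, height_sum F p N <= b) -> height F p <= b.
Proof.
by move=> H; apply: ge_sup; [exists (height_sum F p 0), 0%N|move=> _ [N _ <-]].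
Qed.

Lemma height_lip F p q : one_vertical F -> F p -> F q ->
  height F q <= height F p + 4 * kor_dist p q.
Proof.
move=> vF Fp Fq; apply: height_le => N.
by have := height_sum_lip N vF Fp Fq; have := height_ub N Fp; lra.
Qed.

(** A bump centred close enough to [q] is larger at [q] than at all points up to
[p], since these stay at distance at least d(p,q)/2 from [q]. *)
Lemma past_bump_separates F p q : one_vertical F -> F p -> F q ->
  0 < zrel p q ->
  exists n, past_bump F (rat_point n) p < past_bump F (rat_point n) q.
Proof.
move=> vF Fp Fq pq.
have d0 : 0 < kor_dist p q.
  by apply: kor_dist_gt0 => pq'; rewrite pq' zrel_refl ltxx in pq.
have m0 : 0 < Num.min 1 (kor_dist p q / 4).
  by rewrite lt_min ltr01 divr_gt0.
have [x] := kor_rat_dense q m0; rewrite lt_min => /andP[x1 xd].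
exists (pickle x); rewrite /rat_point pickleK.
move: x1 xd; set y : heis R := (_, _, _) => x1 xd.
apply: (@lt_le_trans _ _ (1 - kor_dist y q)); last first.
  apply: (@le_trans _ _ (bump y q)); first by rewrite /bump le_max lexx orbT.
  by apply: past_bump_ub; rewrite ?zrel_refl.
apply: (@le_lt_trans _ _ (Num.max 0 (1 - kor_dist p q / 4))).
  apply: past_bump_le => // e Fe ep; rewrite /bump.
  apply: le_max2 => //; rewrite lerD2l lerN2.
  have [_ H] := kor_dist_between vF Fe Fp Fq ep (ltW pq).
  by have := kor_dist_triangle y e q; rewrite (kor_dist_sym e y); lra.
by rewrite gt_max; apply/andP; split; lra.
Qed.

Lemma height_lt F p q : one_vertical F -> F p -> F q ->
  0 < zrel p q -> height F p < height F q.
Proof.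
move=> vF Fp Fq pq; have [n Hn] := past_bump_separates vF Fp Fq pq.
pose c := 2^-1 ^+ n * (past_bump F (rat_point n) q - past_bump F (rat_point n)
  p).
have c0 : 0 < c by rewrite mulr_gt0 ?subr_gt0 // exprn_gt0 // invr_gt0.
suff : height F p <= height F q - c by lra.
apply: height_le => N.
have mono k : 2^-1 ^+ k * past_bump F (rat_point k) p
           <= 2^-1 ^+ k * past_bump F (rat_point k) q.
  rewrite ler_wpM2l ?exprn_ge0 ?invr_ge0 //.
  by apply: past_bump_mono => //; exact: ltW.
(* Summing past the index [n] makes its strict gain [c] visible. *)
have step : height_sum F p (N + n.+1) + c <= height_sum F q (N + n.+1).
  have nN : (n < N + n.+1)%N by rewrite addnS ltnS leq_addl.
  rewrite /height_sum (bigD1 (Ordinal nN)) //= [leRHS](bigD1 (Ordinal nN)) //=.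
  rewrite addrAC lerD //; last by apply: ler_sum => k _; exact: mono.
  by rewrite /c mulrBr addrC subrK.
have : height_sum F p N <= height_sum F p (N + n.+1).
  rewrite /height_sum big_split_ord /= lerDl; apply: sumr_ge0 => k _.
  by rewrite mulr_ge0 ?exprn_ge0 ?invr_ge0 //; exact: past_bump_ge0.
by have := height_ub (N + n.+1) Fq; lra.
Qed.

End HeightFunction.

(** * Closed vertical curves without gaps are open arcs *)
Section VerticalArcs.
Context {R : realType}.
Implicit Types (p q r e x : heis R) (E F : set (heis R)).

(** Points in every relative height, up to a factor.  Letting [t] tend to zero
excludes gaps, and letting it tend to infinity excludes ends. *)
Definition no_gaps F := forall p (t : R), F p -> t != 0 ->
  exists2 q, F q & `|zrel p q - t| <= `|t| / 2.

Lemma height_ltE F p q : one_vertical F -> F p -> F q ->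
  (height F p < height F q) = (0 < zrel p q).
Proof.
move=> vF Fp Fq; apply/idP/idP; last exact: height_lt.
move=> pq; rewrite ltNge; apply/negP => qp.
have [z0|z0] := eqVneq (zrel p q) 0.
  by rewrite (zrel_inj vF Fp Fq z0) ltxx in pq.
have : 0 < zrel q p by rewrite zrelC oppr_gt0 lt_neqAle z0.
by move=> /(height_lt vF Fq Fp); rewrite ltNge ltW.
Qed.

Lemma height_leE F p q : one_vertical F -> F p -> F q ->
  (height F p <= height F q) = (0 <= zrel p q).
Proof.
by move=> vF Fp Fq; rewrite leNgt (height_ltE vF) // zrelC oppr_gt0 -leNgt.
Qed.

Lemma height_inj F p q : one_vertical F -> F p -> F q ->
  height F p = height F q -> p = q.
Proof.
move=> vF Fp Fq pq; apply: (zrel_inj vF Fp Fq); apply/eqP.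
rewrite eq_le !leNgt -(height_ltE vF) // pq ltxx /=.
by rewrite -oppr_gt0 -zrelC -(height_ltE vF) // pq ltxx.
Qed.

(** With |t| = e^2/8 the relative height is at most 3 e^2/16, and then
d^4 <= 17 (3/16)^2 e^4 < e^4. *)
Lemma no_gaps_near F p (t e : R) : one_vertical F -> no_gaps F -> F p ->
  0 < e -> `|t| = e ^+ 2 / 8 ->
  exists q, [/\ F q, `|zrel p q - t| <= `|t| / 2 & kor_dist p q < e].
Proof.
move=> vF gF Fp e0 te; have e2 : 0 < e ^+ 2 by rewrite exprn_gt0.
have [|q Fq H] := gF p t Fp; first by rewrite -normr_gt0 te divr_gt0.
exists q; split => //; rewrite -(@ltr_pXn2r _ 4) ?nnegrE ?kor_dist_ge0 ?ltW //.
have Z : `|zrel p q| <= 3 / 16 * e ^+ 2.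
  have := ler_distD t (zrel p q) 0; rewrite !subr0 te in H *.
  by lra.
have Z2 : `|zrel p q| ^+ 2 <= (3 / 16 * e ^+ 2) ^+ 2.
  by rewrite ler_pXn2r ?nnegrE // mulr_ge0 // ltW.
have h0 : 0 <= (hx q - hx p) ^+ 2 + (hy q - hy p) ^+ 2.
  by rewrite addr_ge0 ?sqr_ge0.
have h2 : ((hx q - hx p) ^+ 2 + (hy q - hy p) ^+ 2) ^+ 2 <= `|zrel p q| ^+ 2.
  by rewrite ler_pXn2r ?nnegrE //; exact: vF.
rewrite kor_dist4 -[zrel p q ^+ 2](real_normK (num_real _)).
have : 0 < e ^+ 4 by rewrite exprn_gt0.
rewrite (_ : (3 / 16 * e ^+ 2) ^+ 2 = 9 / 256 * e ^+ 4) in Z2; last by field.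
lra.
Qed.

Lemma exists_above F p (e : R) : one_vertical F -> no_gaps F -> F p -> 0 < e ->
  exists q, [/\ F q, height F p < height F q & kor_dist p q < e].
Proof.
move=> vF gF Fp e0; have t0 : 0 < e ^+ 2 / 8 by rewrite divr_gt0 ?exprn_gt0.
have [q [Fq H d]] := no_gaps_near vF gF Fp e0 (gtr0_norm t0).
exists q; split => //; rewrite (height_ltE vF) //.
by move: H; rewrite (gtr0_norm t0) ler_distl; lra.
Qed.

Lemma exists_below F p (e : R) : one_vertical F -> no_gaps F -> F p -> 0 < e ->
  exists q, [/\ F q, height F q < height F p & kor_dist p q < e].
Proof.
move=> vF gF Fp e0; have t0 : 0 < e ^+ 2 / 8 by rewrite divr_gt0 ?exprn_gt0.
have tN : `|- (e ^+ 2 / 8)| = e ^+ 2 / 8 by rewrite normrN gtr0_norm.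
have [q [Fq H d]] := no_gaps_near vF gF Fp e0 tN.
exists q; split => //; rewrite (height_ltE vF) // zrelC.
by move: H; rewrite tN ler_distl; lra.
Qed.

Lemma closed_zrel_ge p : closed [set e | 0 <= zrel p e].
Proof.
apply: (@closed_comp _ _ (zrel p) [set t | 0 <= t]); last exact: closed_ge.
by move=> e _; exact: zrel_continuous.
Qed.

Lemma closed_zrel_le p : closed [set e | 0 <= zrel e p].
Proof.
rewrite (_ : mkset _ = zrel p @^-1` [set t | t <= 0]).
  apply: closed_comp; last exact: closed_le.
  by move=> e _; exact: zrel_continuous.
by apply/seteqP; split => e /=; rewrite [zrel e p]zrelC oppr_ge0.
Qed.

Definition curve_arc F p q :=
  F `&` ([set e | 0 <= zrel p e] `&` [set e | 0 <= zrel e q]).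

Lemma curve_arc_compact F p q : one_vertical F -> closed F -> F p -> F q ->
  compact (curve_arc F p q).
Proof.
move=> vF clF Fp Fq.
apply: (@kor_bounded_compact _ _ p (2 * kor_dist p q)).
  by apply: closedI => //; apply: closedI; [exact: closed_zrel_ge|
    exact: closed_zrel_le].
by move=> e [Fe [pe eq]]; case: (kor_dist_between vF Fp Fe Fq pe eq).
Qed.

Lemma height_continuous F : one_vertical F -> {within F, continuous height F}.
Proof.
move=> vF; apply: (@kor_lipschitz_continuous _ _ _ 4) => p q.
exact: height_lip.
Qed.

(** Take a point of the order segment whose height is closest to [y]; the
segment is compact.  Were its height not [y], a sufficiently near point of [F]
in the right direction would be closer. *)
Lemma height_intermediate F p q y : one_vertical F -> no_gaps F -> closed F ->
  F p -> F q -> height F p < y < height F q ->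
  exists2 e, F e & height F e = y.
Proof.
move=> vF gF clF Fp Fq /andP[py yq].
have pq : 0 < zrel p q by rewrite -(height_ltE vF) //; exact: lt_trans yq.
pose f e := `|height F e - y|.
have cK := curve_arc_compact vF clF Fp Fq.
have arc0 : curve_arc F p q !=set0.
  by exists p; split => //; split => /=; rewrite ?zrel_refl // ltW.
have fC : {within curve_arc F p q, continuous f}.
  apply: (@kor_lipschitz_continuous _ _ _ 4) => u v [Fu _] [Fv _].
  rewrite /f; have := ler_distD (height F u) (height F v) y.
  suff : `|height F v - height F u| <= 4 * kor_dist u v by lra.
  rewrite ler_distl; have := height_lip vF Fu Fv; have := height_lip vF Fv Fu.
  by rewrite (kor_dist_sym v u); lra.
have [e] := compact_EVT_min arc0 cK fC.
rewrite inE => -[Fe [/= pe eq]] emin.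
have arcI u : F u -> height F p <= height F u -> height F u <= height F q ->
    u \in curve_arc F p q.
  by move=> Fu pu uq; rewrite inE; split => //; split;
    rewrite /= -(height_leE vF).
exists e => //; have [ey|ey|//] := ltgtP (height F e) y; exfalso.
- have g0 : 0 < (y - height F e) / 4 by lra.
  have [u [Fu eu d]] := exists_above vF gF Fe g0.
  have uL := height_lip vF Fe Fu; rewrite -(height_leE vF) // in pe.
  have := emin u; rewrite /f ltr0_norm; last by lra.
  rewrite ltr0_norm; last by lra.
  have -> : u \in curve_arc F p q by apply: arcI => //; lra.
  by move=> /(_ isT); lra.
- have g0 : 0 < (height F e - y) / 4 by lra.
  have [u [Fu ue d]] := exists_below vF gF Fe g0.
  have uL := height_lip vF Fu Fe; rewrite kor_dist_sym in d.
  rewrite -(height_leE vF) // in eq.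
  have := emin u; rewrite /f gtr0_norm; last by lra.
  rewrite gtr0_norm; last by lra.
  have -> : u \in curve_arc F p q by apply: arcI => //; lra.
  by move=> /(_ isT); lra.
Qed.

Lemma height_image_interval F : one_vertical F -> no_gaps F -> closed F ->
  is_interval (height F @` F).
Proof.
move=> vF gF clF _ _ [p Fp <-] [q Fq <-] y /andP[].
rewrite le_eqVlt => /orP[/eqP <- _|py]; first by exists p.
rewrite le_eqVlt => /orP[/eqP ->|yq]; first by exists q.
have [|e Fe <-] := @height_intermediate F p q y vF gF clF Fp Fq;
  last by exists e.
by rewrite py.
Qed.

Lemma height_image_open F : one_vertical F -> no_gaps F -> closed F ->
  open (height F @` F).
Proof.
move=> vF gF clF; rewrite openE => _ [p Fp <-].
have [u [Fu pu _]] := exists_above vF gF Fp ltr01.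
have [v [Fv vp _]] := exists_below vF gF Fp ltr01.
rewrite /interior; have : nbhs (height F p) `]height F v, height F u[%classic.
  by apply: near_in_itvoo; rewrite in_itv /= vp.
apply: filterS => y /=; rewrite in_itv /= => yvu.
by have [e Fe <-] := height_intermediate vF gF clF Fv Fu yvu; exists e.
Qed.

Definition height_inv F (y : R) : heis R :=
  xget 1%g [set p | F p /\ height F p = y].

Lemma height_invK F p : one_vertical F -> F p -> height_inv F (height F p) = p.
Proof.
move=> vF Fp; apply: xget_unique; first by [].
by move=> q [Fq qp]; exact: (height_inj vF).
Qed.

(** The interval of heights between two points close to [p] corresponds to an
order segment, and order segments with close ends have small diameter. *)
Lemma height_inv_continuous F : one_vertical F -> no_gaps F -> closed F ->
  {within height F @` F, continuous height_inv F}.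
Proof.
move=> vF gF clF; apply/subspace_continuousP => _ [p Fp <-].
rewrite /from_subspace height_invK // => U /nbhs_kor_ball[e e0 eU].
have e20 : 0 < e / 2 by lra.
have [u [Fu pu du]] := exists_above vF gF Fp e20.
have [v [Fv vp dv]] := exists_below vF gF Fp e20.
have : nbhs (height F p) `]height F v, height F u[%classic.
  by apply: near_in_itvoo; rewrite in_itv /= vp.
apply: (@filterS _ (nbhs (height F p))) => y /=;
  rewrite in_itv /= => /andP[vy yu] [q Fq qy].
rewrite -qy in vy yu *; rewrite height_invK //; apply: eU.
rewrite (height_ltE vF) // in vy; rewrite (height_ltE vF) // in yu.
have [pq|pq] := lerP 0 (zrel p q).
  by have [H _] := kor_dist_between vF Fp Fq Fu pq (ltW yu); lra.
have qp : 0 <= zrel q p by rewrite zrelC; lra.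
have [_ H] := kor_dist_between vF Fv Fq Fp (ltW vy) qp.
by rewrite (kor_dist_sym p) in dv *; rewrite kor_dist_sym; lra.
Qed.

Lemma no_gaps_has_no_endpoints F : one_vertical F -> no_gaps F -> closed F ->
  F !=set0 -> has_no_endpoints F.
Proof.
move=> vF gF clF [p Fp]; exists (height F @` F); split.
- by exists (height F p), p.
- exact: height_image_open.
- exact: height_image_interval.
exists (height_inv F), (height F); split.
- exact: height_inv_continuous.
- exact: height_continuous.
- by split => // _ [_ [q Fq <-] <-]; rewrite height_invK.
- by move=> _ [q Fq <-]; rewrite height_invK.
- by move=> q Fq; rewrite height_invK.
Qed.

Lemma no_gaps_connected F : one_vertical F -> no_gaps F -> closed F ->
  connected F.
Proof.
move=> vF gF clF.
rewrite (_ : F = height_inv F @` (height F @` F)).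
  apply: connected_continuous_connected; last exact: height_inv_continuous.
  by apply/connected_intervalP; exact: height_image_interval.
apply/seteqP; split => [q Fq|_ [_ [q Fq <-] <-]]; last by rewrite height_invK.
by exists (height F q); [exists q|rewrite height_invK].
Qed.

End VerticalArcs.

(** * A closed arc without endpoints fills the curve *)
Section Rigidity.
Context {R : realType}.
Implicit Types (p q r e x : heis R) (E F : set (heis R)).

(** On both sides of a maximum the intermediate value theorem would give the
same value twice. *)
Lemma injective_no_max (I : set R) (f : R -> R) (t : R) :
  open I -> {within I, continuous f} ->
  (forall s u, I s -> I u -> f s = f u -> s = u) -> I t ->
  exists2 s, I s & f t < f s.
Proof.
move=> oI fC finj It.
have /nbhs_ballP[d /= d0 dI] : nbhs t I by exact: open_nbhs_nbhs.
apply: contrapT => /forall2NP max.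
have fle s : I s -> f s <= f t.
  by move=> Is; case: (max s) => // /negP; rewrite -leNgt.
pose a := t - d / 2; pose b := t + d / 2.
have sub s : a <= s <= b -> I s.
  move=> /andP[sa sb]; apply: dI; rewrite /ball /= ltr_norml.
  by rewrite /a /b in sa sb; lra.
have flt s : I s -> s != t -> f s < f t.
  move=> Is st; rewrite lt_neqAle fle // andbT.
  by apply: contra st => /eqP /(finj _ _ Is It) ->.
have ia : I a by apply: sub; rewrite /a /b; lra.
have ib : I b by apply: sub; rewrite /a /b; lra.
have fa : f a < f t by apply: flt => //; rewrite /a; lra.
have fb : f b < f t by apply: flt => //; rewrite /b; lra.
pose v := Num.max (f a) (f b).
have vt : v < f t by rewrite /v gt_max fa.
have at_ : a <= t by rewrite /a; lra.
have tb : t <= b by rewrite /b; lra.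
have fCl : {within `[a, t], continuous f}.
  apply: continuous_subspaceW fC => s /=; rewrite in_itv /= => /andP[sa st].
  by apply: sub; rewrite sa (le_trans st).
have fCr : {within `[t, b], continuous f}.
  apply: continuous_subspaceW fC => s /=; rewrite in_itv /= => /andP[ts sb].
  by apply: sub; rewrite sb andbT (le_trans at_).
have vl : Num.min (f a) (f t) <= v <= Num.max (f a) (f t).
  by rewrite ge_min !le_max lexx (ltW vt) orbT.
have vr : Num.min (f t) (f b) <= v <= Num.max (f t) (f b).
  by rewrite ge_min !le_max lexx (ltW vt) !orbT.
have [s1] := IVT at_ fCl vl; rewrite in_itv /= => /andP[as1 s1t] fs1.
have [s2] := IVT tb fCr vr; rewrite in_itv /= => /andP[ts2 s2b] fs2.
have s12 : s1 = s2.
  apply: finj; rewrite ?fs1 //; apply: sub; rewrite ?as1 ?s2b ?andbT /=.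
    exact: le_trans tb.
  exact: le_trans ts2.
have st : s1 = t by apply/eqP; rewrite eq_le s1t s12 ts2.
by rewrite -fs1 st ltxx in vt.
Qed.

Lemma no_endpoints_no_max E (f : heis R -> R) p :
  has_no_endpoints E -> {within E, continuous f} ->
  (forall q r, E q -> E r -> f q = f r -> q = r) -> E p ->
  exists2 q, E q & f p < f q.
Proof.
move=> [I [_ oI _ [u [v [uC vC [uE vI] uK vK]]]]] fC finj Ep.
have uI s : I s -> E (u s) by move=> Is; apply: uE; exists s.
have Ivp : I (v p) by apply: vI; exists p.
have fuC : {within I, continuous (f \o u)}.
  move/subspace_continuousP: uC => uC; move/subspace_continuousP: fC => fC.
  apply/subspace_continuousP => s Is A /(fC _ (uI _ Is)) /= H.
  apply: (@filterS _ (nbhs s)) (uC _ Is _ H) => w /= Hw Iw.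
  by apply: Hw => //; exact: uI.
have [s1 s2 I1 I2 E12|s Is] := injective_no_max oI fuC _ Ivp.
  by rewrite -(uK _ I1) -(uK _ I2) (finj _ _ (uI _ I1) (uI _ I2) E12).
by rewrite /= vK // => lt; exists (u s) => //; exact: uI.
Qed.

(** If [F] had a point [p] outside [E], connectedness would put [E] on one side
of [p].  Then the height gap to [p] is injective on [E], and by compactness of
order segments it has a minimum, which an open arc does not allow. *)
Lemma no_endpoints_maximal E F : one_vertical F -> no_gaps F -> closed F ->
  E `<=` F -> E !=set0 -> closed E -> connected E -> has_no_endpoints E ->
  F `<=` E.
Proof.
move=> vF gF clF EF [e0 Ee0] clE cE nE p Fp; apply: contrapT => nEp.
have hC : {within E, continuous height F}.
  exact: continuous_subspaceW EF (height_continuous vF).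
have itv : is_interval (height F @` E).
  by apply/connected_intervalP; exact: connected_continuous_connected.
have np e : E e -> height F e != height F p.
  by move=> Ee; apply/eqP => /(height_inj vF (EF _ Ee) Fp) ep;
    rewrite -ep in nEp.
have no_cross a b : E a -> E b -> height F a < height F p ->
    height F p < height F b -> False.
  move=> Ea Eb ap pb.
  have [q Eq /eqP] : (height F @` E) (height F p); last first.
    by rewrite (negbTE (np _ Eq)).
  by apply: (itv (height F a) (height F b)); [exists a|exists b|rewrite !ltW].
have side e : E e -> (height F e < height F p) = (height F e0 < height F p).
  move=> Ee; have := np _ Ee; have := np _ Ee0; have := no_cross e e0 Ee Ee0.
  have := no_cross e0 e Ee0 Ee.
  case: ltgtP => // _; case: ltgtP => // _; first by move=> /(_ isT isT).
  by move=> _ /(_ isT isT).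
pose f e := - `|height F e - height F p|.
have fC : {within E, continuous f}.
  apply: (@kor_lipschitz_continuous _ _ _ 4) => u v /EF Fu /EF Fv.
  rewrite /f; have := ler_distD (height F v) (height F u) (height F p).
  suff : `|height F u - height F v| <= 4 * kor_dist u v by lra.
  rewrite ler_distl; have := height_lip vF Fu Fv; have := height_lip vF Fv Fu.
  by rewrite (kor_dist_sym v u); lra.
have finj q r : E q -> E r -> f q = f r -> q = r.
  move=> Eq Er /oppr_inj; have := side _ Eq; rewrite -(side _ Er).
  have := np _ Eq; have := np _ Er => rp qp sd fqr.
  apply: (height_inj vF (EF _ Eq) (EF _ Er)); move: fqr.
  have [rlt|rgt|/eqP] := ltgtP (height F r) (height F p); last 1 first.
  - by rewrite (negbTE rp).
  - rewrite rlt in sd; rewrite !ltr0_norm; lra.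
  - have qgt : height F p < height F q by rewrite lt_neqAle eq_sym qp leNgt sd
    ltNge ltW.
    rewrite !gtr0_norm; lra.
pose K := (curve_arc F e0 p `|` curve_arc F p e0) `&` E.
have Fe0 := EF _ Ee0.
have cK : compact K.
  by apply: compact_closedI => //; apply: compactU; exact: curve_arc_compact.
(* Points of [E] closer to [p] in height than [e0] lie between the two; the
   union in [K] covers both possible sides. *)
have KI q : E q -> f e0 <= f q -> K q.
  move=> Eq fq; split => //; have Fq := EF _ Eq.
  move: fq; have := side _ Eq; have := np _ Eq; have := np _ Ee0; rewrite /f.
  have [lt0|lt0|//] := ltgtP (height F e0) (height F p).
  - move=> _ _ qp; rewrite !ltr0_norm; [|lra..] => H; left.
    by split => //; split; rewrite /= -(height_leE vF) //; lra.
  - move=> _ qn /negbT; rewrite -leNgt => qp.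
    rewrite !ger0_norm; [|lra..] => H; right.
    by split => //; split; rewrite /= -(height_leE vF) //; lra.
have [m] := compact_EVT_max (ex_intro _ e0 (KI _ Ee0 (lexx _))) cK
  (continuous_subspaceW (@subIsetr _ _ _) fC).
rewrite inE => -[_ Em] mmax.
have [q Eq mq] := no_endpoints_no_max nE fC finj Em.
have e0m := mmax e0 (mem_set (KI _ Ee0 (lexx _))).
have := mmax q (mem_set (KI _ Eq (le_trans e0m (ltW mq)))).
by rewrite leNgt mq.
Qed.

End Rigidity.

(** * Intrinsic Lipschitz graphs as graphs of Lipschitz functions *)
Section IntrinsicGraphs.
Context {R : realType}.
Implicit Types (p q r w v : heis R) (E W : set (heis R)) (L : R).

Definition hlin (a b : R) p : R := a * hx p + b * hy p.

Definition hline (a b t : R) : heis R := (t * a, t * b, 0).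

Definition kor_lipschitz L (g : heis R -> R) :=
  forall p q, `|g p - g q| <= L * kor_dist p q.

Definition lin_graph a b (g : heis R -> R) : set (heis R) :=
  [set p | hlin a b p = g p].

Lemma vertical_subgroup_unit W : vertical_subgroup W ->
  exists a b, a ^+ 2 + b ^+ 2 = 1 /\ W = [set p | hlin a b p = 0].
Proof.
move=> [a [b [ab0 ->]]].
have s0 : 0 < a ^+ 2 + b ^+ 2.
  rewrite lt_neqAle addr_ge0 ?sqr_ge0 // andbT eq_sym.
  apply: contra ab0; rewrite paddr_eq0 ?sqr_ge0 // !sqrf_eq0.
  by move=> /andP[/eqP -> /eqP ->].
pose n := Num.sqrt (a ^+ 2 + b ^+ 2).
have n0 : 0 < n by rewrite sqrtr_gt0.
exists (a / n), (b / n); split.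
  by rewrite !expr_div_n -mulrDl sqr_sqrtr ?divff ?gt_eqF // ltW.
apply/seteqP; split => p; rewrite /hlin /= ![_ / n * _]mulrAC -mulrDl.
  by move=> ->; rewrite mul0r.
by move=> /eqP; rewrite mulf_eq0 invr_eq0 (gt_eqF n0) orbF => /eqP.
Qed.

Lemma hlin_horizontal a b (t : R) : a ^+ 2 + b ^+ 2 = 1 ->
  hlin a b (hline a b t) = t.
Proof.
move=> n1; rewrite /hlin /hline /hx /hy /= -[RHS]mulr1 -n1; ring.
Qed.

Lemma hlinM a b p q : hlin a b (p * q)%g = hlin a b p + hlin a b q.
Proof. by rewrite /hlin !heisE; ring. Qed.

Lemma hlinV a b p : hlin a b (p^-1)%g = - hlin a b p.
Proof. by rewrite /hlin !heisE; ring. Qed.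

Lemma kor_norm_horizontal_line a b (t : R) : a ^+ 2 + b ^+ 2 = 1 ->
  kor_norm (hline a b t) = `|t|.
Proof.
move=> n1; apply/eqP; rewrite -(@eqrXn2 _ 4) ?kor_norm_ge0 //.
apply/eqP; rewrite kor_norm4 /hline /hx /hy /hz /=.
rewrite (_ : `|t| ^+ 4 = t ^+ 4); last by rewrite -normrX ger0_norm //
  exprn_even_ge0.
rewrite -[RHS]mulr1 -(expr1n _ 2) -n1; ring.
Qed.

Lemma hlin_le_norm a b p : a ^+ 2 + b ^+ 2 = 1 -> `|hlin a b p| <= kor_norm p.
Proof.
move=> n1; apply: (@ler_of_pow _ 1); first exact: kor_norm_ge0.
apply: le_trans (kor_norm_horizontal p); rewrite real_normK ?num_real //.
rewrite -[leRHS]mul1r -n1 -subr_ge0 /hlin.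
rewrite (_ : _ - _ = (a * hy p - b * hx p) ^+ 2) ?sqr_ge0 //; ring.
Qed.

(** The linear form is invariant under [W] and bounded by the norm; the
orthogonal projection along the horizontal normal line attains the bound. *)
Lemma kor_dist_setE a b p : a ^+ 2 + b ^+ 2 = 1 ->
  kor_dist_set p [set q | hlin a b q = 0] = `|hlin a b p|.
Proof.
move=> n1; apply/eqP; rewrite eq_le; apply/andP; split.
  pose v := hline a b (hlin a b p).
  apply: ge_inf.
    by exists 0 => _ [w _ <-]; exact: kor_dist_ge0.
  exists (p * v^-1)%g; first by rewrite /= hlinM hlinV hlin_horizontal // subrr.
  by rewrite /kor_dist invgM invgK mulgVK kor_norm_horizontal_line.
apply: lb_le_inf.
  by exists (kor_dist p 1%g), 1%g => //=; rewrite /hlin /hx /hy /=; ring.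
move=> _ [w /= w0 <-]; rewrite /kor_dist.
apply: le_trans (hlin_le_norm _ n1).
by rewrite hlinM hlinV w0 oppr0 add0r.
Qed.

Lemma translateP p q E : translate p E q <-> E (p^-1 * q)%g.
Proof.
split=> [[r Er <-]|Epq]; first by rewrite mulKg.
by exists (p^-1 * q)%g => //; rewrite mulVKg.
Qed.

Lemma iLip_graphP a b L E : a ^+ 2 + b ^+ 2 = 1 ->
  iLip_graph [set q | hlin a b q = 0] L E <->
  (forall p q, E p -> E q -> `|hlin a b p - hlin a b q| <= L * kor_dist p q).
Proof.
move=> n1.
have cone p q : intrinsic_cone [set q | hlin a b q = 0] L (p^-1 * q)%g <->
    `|hlin a b p - hlin a b q| <= L * kor_dist p q.
  rewrite /intrinsic_cone /= kor_dist_setE // hlinM hlinV kor_distV invg1 mul1g.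
  by rewrite -kor_distV addrC distrC.
split=> H p.
  by move=> q Ep Eq; apply/cone/translateP; exact: H.
by move=> Ep q Eq; apply/translateP/cone; exact: H.
Qed.

(** The extension is the infimum over [p] in [E] of [f p + L * d(p, q)];
the triangle inequality for [d] holds without a constant, so the Lipschitz
constant of [f] is kept. *)
Lemma mcshane_extension L E (f : heis R -> R) : 0 <= L -> E !=set0 ->
  (forall p q, E p -> E q -> `|f p - f q| <= L * kor_dist p q) ->
  exists2 g, kor_lipschitz L g & forall p, E p -> f p = g p.
Proof.
move=> L0 [e0 Ee0] fL.
pose S q := [set f p + L * kor_dist p q | p in E].
have S0 q : S q !=set0 by exists (f e0 + L * kor_dist e0 q), e0.
have Slb q b : (forall p, E p -> b <= f p + L * kor_dist p q) -> b <= inf (S q).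
  by move=> H; apply: lb_le_inf => // _ [p Ep <-]; exact: H.
have Sle q p : E p -> inf (S q) <= f p + L * kor_dist p q.
  move=> Ep; apply: ge_inf; last by exists p.
  exists (f e0 - L * kor_dist e0 q) => _ [r Er <-].
  have := fL _ _ Ee0 Er; rewrite ler_distl => /andP[_ H].
  have := ler_wpM2l L0 (kor_dist_triangle q e0 r).
  by rewrite mulrDr (kor_dist_sym q r); lra.
have lip q r : inf (S q) - L * kor_dist q r <= inf (S r).
  apply: Slb => p Ep; have := Sle q p Ep.
  have := ler_wpM2l L0 (kor_dist_triangle r p q).
  by rewrite mulrDr (kor_dist_sym r q); lra.
exists (fun q => inf (S q)).
  move=> q r; rewrite ler_distl; have := lip q r; have := lip r q.
  by rewrite (kor_dist_sym r q); lra.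
move=> p Ep; apply/eqP; rewrite eq_le; apply/andP; split.
  apply: Slb => q Eq; have := fL _ _ Ep Eq; rewrite ler_distl.
  by rewrite kor_dist_sym; lra.
by have := Sle p p Ep; rewrite kor_dist_refl mulr0 addr0.
Qed.

Lemma hline0 a b : hline a b 0 = 1%g.
Proof. by rewrite /hline !mul0r. Qed.

Lemma hlineD a b s t : (hline a b s * hline a b t)%g = hline a b (s + t).
Proof. by apply: heis_eq; rewrite !heisE /hline /hx /hy /hz /=; ring. Qed.

Lemma hlineN a b t : ((hline a b t)^-1)%g = hline a b (- t).
Proof. by apply: heis_eq; rewrite !heisE /hline /hx /hy /hz /=; ring. Qed.

Lemma hlineB a b s t : ((hline a b s)^-1 * hline a b t)%g = hline a b (t - s).
Proof. by rewrite hlineN hlineD addrC. Qed.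

(** Along the line the form grows with slope one and [g] with slope at most
[L < 1], so their difference changes sign. *)
Lemma lipschitz_meets_line a b L (g : heis R -> R) w :
  a ^+ 2 + b ^+ 2 = 1 -> L < 1 -> kor_lipschitz L g ->
  exists t : R, lin_graph a b g (w * hline a b t)%g.
Proof.
move=> n1 L1 gL; pose f t := hlin a b w + t - g (w * hline a b t)%g.
suff [t ft] : exists t, f t = 0.
  exists t; rewrite /lin_graph /= hlinM hlin_horizontal //.
  by apply/eqP; rewrite -subr_eq0; exact/eqP.
have glip s t : `|g (w * hline a b s)%g - g (w * hline a b t)%g| <= L * `|t -
  s|.
  apply: le_trans (gL _ _) _; rewrite kor_distV invgM mulgA mulgVK hlineB.
  by rewrite kor_norm_horizontal_line.
have fC : continuous f.
  move=> t; apply: cvgB; first by apply: cvgD; [exact: cvg_cst|exact: cvg_id].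
  apply/cvgrPdist_lt => e e0; near=> s.
  apply: le_lt_trans (glip t s) _.
  have : `|s - t| < e.
    by rewrite distrC; near: s; apply/nbhs_ballP; exists e.
  have := normr_ge0 (s - t); have [L0|L0] := lerP L 0.
    have := mulr_ge0_le0 (normr_ge0 (s - t)) L0; rewrite mulrC; lra.
  have := ler_piMl (normr_ge0 (s - t)) (ltW L1); lra.
pose c := f 0; pose M := `|c| / (1 - L).
have M0 : 0 <= M by rewrite divr_ge0 // subr_ge0 ltW.
have ME : M * (1 - L) = `|c| by rewrite divfK // subr_eq0 gt_eqF.
have cE : c = hlin a b w - g (w * hline a b 0)%g by rewrite /c /f addr0.
have := ler_norm c; have := ler_norm (- c); rewrite normrN => c1 c2.
have fM : 0 <= f M.
  by have := glip 0 M; rewrite subr0 (ger0_norm M0) ler_distl /f; lra.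
have fN : f (- M) <= 0.
  have := glip 0 (- M); rewrite subr0 normrN (ger0_norm M0) ler_distl /f; lra.
have MM : - M <= M by lra.
have [|t _ ft] := @IVT R f (- M) M 0 MM (continuous_subspaceT fC).
  by rewrite ge_min fN le_max fM orbT.
by exists t.
Unshelve. all: by end_near. Qed.

Lemma horizontal_perp_unit a b : a ^+ 2 + b ^+ 2 = 1 ->
  horizontal_perp [set p | hlin a b p = 0] =
  [set v | exists t, v = hline a b t].
Proof.
move=> n1; apply: horizontal_perpE.
by apply/eqP => -[a0 b0]; move: n1; rewrite a0 b0 expr0n /= addr0 =>
  /esym/eqP; rewrite oner_eq0.
Qed.

Lemma entire_graphP a b E : a ^+ 2 + b ^+ 2 = 1 ->
  vproj [set p | hlin a b p = 0] @` E = [set p | hlin a b p = 0] <->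
  (forall w, exists t : R, E (w * hline a b t)%g).
Proof.
move=> n1; set W := [set p | _].
have WV : vertical_subgroup W.
  exists a, b; split => //.
  apply/eqP => -[a0 b0]; move: n1; rewrite a0 b0 expr0n /= addr0 => /esym/eqP.
  by rewrite oner_eq0.
have perpE := horizontal_perp_unit n1.
split=> [EW w|EW].
  have [w0 [v [W0 + ->]]] := vertical_subgroup_factor w WV.
  rewrite perpE => -[s ->]; move: W0; rewrite -EW => -[p Ep <-].
  have [w1 [v1 [W1 + pE]]] := vertical_subgroup_factor p WV;
    rewrite perpE => -[t vE].
  exists (t - s); rewrite -mulgA hlineD addrC subrK {1}pE vproj_mul //.
    by rewrite -vE -pE.
  by rewrite perpE; exists t.
apply/seteqP; split => [_ [p Ep <-]|w Ww].
  by have [w [v [Ww Wv ->]]] := vertical_subgroup_factor p WV;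
    rewrite vproj_mul.
have [t Et] := EW w; exists (w * hline a b t)%g => //.
by rewrite vproj_mul // perpE; exists t.
Qed.

Lemma lin_graph_entire a b L (g : heis R -> R) :
  a ^+ 2 + b ^+ 2 = 1 -> L < 1 -> kor_lipschitz L g ->
  entire_iLip_graph [set p | hlin a b p = 0] L (lin_graph a b g).
Proof.
move=> n1 L1 gL; split; last first.
  by apply/entire_graphP => // w; exact: lipschitz_meets_line gL.
by apply/iLip_graphP => // p q /= -> ->.
Qed.

(** The extension [g] of the form from [E] has a graph containing [E]; a point
of that graph lies on a normal line that also meets [E], and the two points
coincide because a normal line meets the graph of [g] only once. *)
Lemma entire_graph_lin a b L E :
  a ^+ 2 + b ^+ 2 = 1 -> 0 <= L < 1 ->
  entire_iLip_graph [set p | hlin a b p = 0] L E ->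
  exists2 g, kor_lipschitz L g & E = lin_graph a b g.
Proof.
move=> n1 /andP[L0 L1] [/(iLip_graphP _ _ n1) EL /(entire_graphP _ n1) Een].
have E0 : E !=set0 by have [t Et] := Een 1%g; exists (1 * hline a b t)%g.
have [g gL Eg] := mcshane_extension L0 E0 EL.
exists g => //; apply/seteqP; split => [p|p pg]; first exact: Eg.
have [t Et] := Een p; suff t0 : t = 0.
  by rewrite t0 hline0 mulg1 in Et.
have := Eg _ Et; rewrite hlinM hlin_horizontal // pg => gt.
have := gL (p * hline a b t)%g p.
rewrite -gt kor_dist_sym kor_dist_mulr kor_norm_horizontal_line //.
rewrite addrAC subrr add0r => tt.
apply/eqP; rewrite -normr_eq0; have := normr_ge0 t => t0.
by have [//|tn] := eqVneq `|t| 0; exfalso; have : 0 < `|t| * (1 - L);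
  [rewrite mulr_gt0 ?subr_gt0 // lt_neqAle eq_sym tn|lra].
Qed.

End IntrinsicGraphs.

(** * Points whose horizontal part is a contraction of themselves *)
Section HorizontalContractions.
Context {R : realType}.
Implicit Types (p q r : heis R) (kappa lambda L : R) (gx gy : heis R -> R).

Definition hnorm (u v : R) : R := kor_norm ((u, v, 0) : heis R).

Lemma hnorm_ge0 u v : 0 <= hnorm u v. Proof. exact: kor_norm_ge0. Qed.

Lemma hnorm2 u v : hnorm u v ^+ 2 = u ^+ 2 + v ^+ 2.
Proof.
apply/eqP; rewrite -(@eqrXn2 _ 2) ?sqr_ge0 ?addr_ge0 ?sqr_ge0 //.
by rewrite -exprM kor_norm4 /hx /hy /hz /= expr0n /= mulr0 addr0.
Qed.

Lemma hnorm_le u v (c : R) :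
  0 <= c -> u ^+ 2 + v ^+ 2 <= c ^+ 2 -> hnorm u v <= c.
Proof. by move=> c0 H; apply: (@ler_of_pow _ 1) => //; rewrite hnorm2. Qed.

Lemma hnormD u v u' v' : hnorm (u + u') (v + v') <= hnorm u v + hnorm u' v'.
Proof.
apply: hnorm_le; first by rewrite addr_ge0 ?hnorm_ge0.
apply: (@le_trans _ _ (kor_norm (((u, v, 0) : heis R) * (u', v', 0))%g ^+ 2)).
  exact: (kor_norm_horizontal (((u, v, 0) : heis R) * (u', v', 0))%g).
by rewrite ler_pXn2r ?nnegrE ?addr_ge0 ?hnorm_ge0 ?kor_norm_ge0 //;
  exact: kor_normM.
Qed.

Lemma hnorm_eq0 u v : hnorm u v = 0 -> u = 0 /\ v = 0.
Proof.
move=> h; have /eqP := hnorm2 u v; rewrite h expr0n /= eq_sym.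
by rewrite paddr_eq0 ?sqr_ge0 // !sqrf_eq0 => /andP[/eqP-> /eqP->].
Qed.

Definition horizontal_contraction kappa gx gy := forall p q,
  hnorm (gx q - gx p) (gy q - gy p) <= kappa * kor_dist p q.

Definition fixed_set gx gy : set (heis R) :=
  [set p | hx p = gx p /\ hy p = gy p].

Definition residual gx gy p : R := hnorm (gx p - hx p) (gy p - hy p).

Lemma fixed_setP gx gy p : fixed_set gx gy p <-> residual gx gy p = 0.
Proof.
split=> [[px py]|/hnorm_eq0[/eqP + /eqP]]; last first.
  by rewrite !subr_eq0 => /eqP gxp /eqP gyp; split.
apply/eqP; rewrite -sqrf_eq0 hnorm2 px py !subrr expr0n /=.
by rewrite addr0.
Qed.

Lemma residual_lip kappa gx gy p q : horizontal_contraction kappa gx gy ->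
  residual gx gy q <= residual gx gy p + (kappa + 1) * kor_dist p q.
Proof.
move=> gk; rewrite /residual.
rewrite (_ : gx q - hx q = gx p - hx p + ((gx q - gx p) + (hx p - hx q)));
  last by ring.
rewrite (_ : gy q - hy q = gy p - hy p + ((gy q - gy p) + (hy p - hy q)));
  last by ring.
apply: le_trans (hnormD _ _ _ _) _; rewrite lerD2l mulrDl mul1r.
apply: le_trans (hnormD _ _ _ _) _; apply: lerD; first exact: gk.
apply: hnorm_le; first exact: kor_dist_ge0.
by rewrite kor_dist_sym; exact: kor_dist_horizontal.
Qed.

Lemma residual_move kappa gx gy p : horizontal_contraction kappa gx gy ->
  let q := (p * ((gx p - hx p, gy p - hy p, 0) : heis R))%g in
  kor_dist p q = residual gx gy p /\
  residual gx gy q <= kappa * residual gx gy p.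
Proof.
move=> gk q; have dq : kor_dist p q = residual gx gy p by rewrite kor_dist_mulr.
split => //; rewrite -dq {1}/residual.
have -> : hx q = gx p by rewrite hx_mul [hx (_, _, _)]/hx /=; ring.
have -> : hy q = gy p by rewrite hy_mul [hy (_, _, _)]/hy /=; ring.
exact: gk.
Qed.

(** A fixed-point argument in variational form: minimise the residual plus a
small multiple of the distance from [p] over a large compact ball.  At a
minimum with positive residual [r], the horizontal move would lower the
residual by [(1 - kappa) * r] at the cost of a displacement [r]. *)
Lemma fixed_set_near kappa gx gy p : kappa < 1 ->
  horizontal_contraction kappa gx gy ->
  exists2 q, fixed_set gx gy q &
    (1 - kappa) / 2 * kor_dist p q <= residual gx gy p.
Proof.
move=> k1 gk; pose eps := (1 - kappa) / 2.
have eps0 : 0 < eps by rewrite /eps; lra.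
pose f q := residual gx gy q + eps * kor_dist p q.
(* Outside the ball of radius [M] the functional [f] exceeds its value at
   [p]. *)
pose M := residual gx gy p / eps.
have M0 : 0 <= M by rewrite divr_ge0 ?hnorm_ge0 // ltW.
have ME : eps * M = residual gx gy p by rewrite mulrC divfK // gt_eqF.
pose K := [set q | kor_dist p q <= M].
have clK : closed K.
  rewrite (_ : K = (fun q => kor_dist p q ^+ 4) @^-1` [set t | t <= M ^+ 4]).
    apply: closed_comp; last exact: closed_le.
    by move=> q _; exact: kor_dist4_continuous.
  by apply/seteqP; split => q /=; rewrite ler_pXn2r ?nnegrE ?kor_dist_ge0.
have cK : compact K by apply: (kor_bounded_compact (p := p) (M := M)).
have Kp : K p by rewrite /K /= kor_dist_refl.
have fC : {within K, continuous f}.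
  apply: (@kor_lipschitz_continuous _ _ _ (kappa + 1 + eps)) => q r _ _.
  have := residual_lip q r gk; have := kor_dist_triangle q p r.
  by rewrite /f => /(ler_wpM2l (ltW eps0)); lra.
have [q] := compact_EVT_min (ex_intro _ _ Kp) cK fC.
rewrite inE => Kq qmin; have fp := qmin p (mem_set Kp).
rewrite [f p]/f kor_dist_refl mulr0 addr0 in fp.
have rq := hnorm_ge0 (gx q - hx q) (gy q - hy q);
  rewrite -/(residual _ _ q) in rq.
exists q; last by rewrite -/eps; move: fp; rewrite /f; lra.
apply/fixed_setP/eqP; rewrite eq_le rq andbT leNgt; apply/negP => r0.
have [dq rq'] := residual_move q gk; move: dq rq';
  set q' := (q * _)%g => dq rq'.
have := ler_wpM2l (ltW eps0) (kor_dist_triangle q p q');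
  rewrite dq mulrDr => tq.
have er : eps * residual gx gy q = residual gx gy q / 2 - kappa * residual gx
  gy q / 2.
  by rewrite /eps; field.
have kr : kappa * residual gx gy q < residual gx gy q.
  by rewrite gtr_pMl.
have lt : f q' < f q by rewrite /f; lra.
suff Kq' : K q' by have := qmin q' (mem_set Kq'); rewrite leNgt lt.
have rq'0 := hnorm_ge0 (gx q' - hx q') (gy q' - hy q').
rewrite /K /= -(ler_pM2l eps0) ME.
rewrite -/(residual _ _ q') in rq'0.
by move: lt; rewrite {1}/f; lra.
Qed.

(** The residual is Lipschitz, so it cannot be positive at a limit of points
where it vanishes. *)
Lemma fixed_set_closed kappa gx gy : horizontal_contraction kappa gx gy ->
  closed (fixed_set gx gy).
Proof.
move=> gk p clp; apply/fixed_setP/eqP; apply: contraT => rp0.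
pose c := `|kappa + 1| + 1; have c0 : 0 < c by rewrite ltr_wpDl.
have rp : 0 < residual gx gy p by rewrite lt0r rp0 hnorm_ge0.
have [q [/fixed_setP rq /= dq]] := clp _ (kor_ball_nbhs p (divr_gt0 rp c0)).
rewrite ltr_pdivlMr // in dq.
have := residual_lip q p gk; rewrite rq add0r kor_dist_sym.
have := ler_wpM2r (kor_dist_ge0 p q) (ler_norm (kappa + 1)).
have := kor_dist_ge0 p q; rewrite /c in dq; lra.
Qed.

(** The horizontal displacement [r] satisfies
r^4 <= kappa^4 (r^4 + 16 z^2), which bounds r^2 by a small multiple of |z|. *)
Lemma fixed_set_vertical kappa lambda gx gy p q : 0 < kappa -> 0 <= lambda ->
  kappa ^+ 4 * (16 * lambda ^+ 2 + 1) <= 1 ->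
  horizontal_contraction kappa gx gy ->
  fixed_set gx gy p -> fixed_set gx gy q ->
  lambda * ((hx q - hx p) ^+ 2 + (hy q - hy p) ^+ 2) <= `|zrel p q|.
Proof.
move=> k0 l0 kl gk [px py] [qx qy].
have := gk p q; rewrite -px -py -qx -qy => H.
set s := _ + _; have s0 : 0 <= s by rewrite addr_ge0 ?sqr_ge0.
have k4 : 0 < kappa ^+ 4 by rewrite exprn_gt0.
have s2 : s ^+ 2 <= kappa ^+ 4 * (s ^+ 2 + 16 * zrel p q ^+ 2).
  rewrite -kor_dist4 -exprMn /s -hnorm2 -exprM ler_pXn2r ?nnegrE ?hnorm_ge0 //.
  by rewrite mulr_ge0 ?kor_dist_ge0 // ltW.
apply: (@ler_of_pow _ 1) => //; rewrite exprMn real_normK ?num_real //.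
have := ler_wpM2l (sqr_ge0 s) kl => H2.
by rewrite -(ler_pM2l k4); lra.
Qed.

(** The point [p'] at height [t] above [p] has the horizontal part of [p], so
its residual is at most [kappa] times its distance from [p], which is
2 |t|^(1/2).  A point of the set is then so near to [p'] that its relative
height differs from [t] by at most |t|/4. *)
Lemma fixed_set_no_gaps kappa gx gy : 0 <= kappa -> kappa <= 1 / 5 ->
  horizontal_contraction kappa gx gy -> no_gaps (fixed_set gx gy).
Proof.
move=> k0 k5 gk p t [px py] _.
pose p' := (p * ((0, 0, t) : heis R))%g.
have hx' : hx p' = hx p by rewrite hx_mul [hx (_, _, _)]/hx /= addr0.
have hy' : hy p' = hy p by rewrite hy_mul [hy (_, _, _)]/hy /= addr0.
have z' : zrel p p' = t by rewrite /zrel mulKg.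
pose N := kor_dist p p'; have N0 : 0 <= N := kor_dist_ge0 p p'.
have N2 : N ^+ 2 = 4 * `|t|.
  apply/eqP; rewrite -(@eqrXn2 _ 2) ?sqr_ge0 ?mulr_ge0 //.
  rewrite -exprM kor_dist4 hx' hy' z' exprMn real_normK ?num_real // !subrr.
  by apply/eqP; ring.
have rp' : residual gx gy p' <= kappa * N.
  by rewrite /residual hx' hy' px py; exact: gk.
have [|q Fq dq] := @fixed_set_near kappa gx gy p' _ gk; first by lra.
have d0 := kor_dist_ge0 p' q; exists q => //.
have dN : kor_dist p' q <= N / 2.
  have A : kappa * N <= 1 / 5 * N by rewrite ler_wpM2r.
  have B : kappa * kor_dist p' q <= 1 / 5 * kor_dist p' q by rewrite ler_wpM2r.
  by lra.
rewrite (zrelD p' p q) z' hx' hy' !subrr mul0r mulr0 subrr mulr0 addr0 addrAC.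
rewrite subrr add0r; have := kor_dist_vertical p' q.
have : kor_dist p' q ^+ 2 <= (N / 2) ^+ 2.
  by rewrite ler_pXn2r ?nnegrE // divr_ge0.
have -> : (N / 2) ^+ 2 = N ^+ 2 / 4 by field.
by have := normr_ge0 t; rewrite N2; lra.
Qed.

End HorizontalContractions.

(** * Intersections of two graphs, and the theorem *)
Section GraphIntersection.
Context {R : realType}.
Implicit Types (p q : heis R) (g : heis R -> R).

(** Cramer's rule; as the two normals are unit vectors, the solution of the
linear system is at most 2/|D| times the larger of the right-hand sides. *)
Lemma lin_graph_intersection (a1 b1 a2 b2 L : R) (g1 g2 : heis R -> R) :
  a1 ^+ 2 + b1 ^+ 2 = 1 -> a2 ^+ 2 + b2 ^+ 2 = 1 -> a1 * b2 - a2 * b1 != 0 ->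
  0 <= L -> kor_lipschitz L g1 -> kor_lipschitz L g2 ->
  exists gx gy,
    [/\ horizontal_contraction (2 * L / `|a1 * b2 - a2 * b1|) gx gy &
    lin_graph a1 b1 g1 `&` lin_graph a2 b2 g2 = fixed_set gx gy].
Proof.
set D := a1 * b2 - a2 * b1 => n1 n2 D0 L0 L1 L2.
exists (fun p => (b2 * g1 p - b1 * g2 p) / D).
exists (fun p => (a1 * g2 p - a2 * g1 p) / D); split.
  move=> p q; apply: hnorm_le.
    by rewrite mulr_ge0 ?kor_dist_ge0 // divr_ge0 // mulr_ge0.
  set al := g1 q - g1 p; set be := g2 q - g2 p.
  rewrite (_ : _ / D - _ / D = (b2 * al - b1 * be) / D); last first.
    by rewrite /al /be; field.
  rewrite (_ : (a1 * g2 q - _) / D - _ / D = (a1 * be - a2 * al) / D);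
    last first.
    by rewrite /al /be; field.
  have D2 : 0 < D ^+ 2 by rewrite lt0r sqrf_eq0 D0 sqr_ge0.
  have sq (x : R) g : kor_lipschitz L g -> x = g q - g p ->
      x ^+ 2 <= (L * kor_dist p q) ^+ 2.
    move=> gL ->; rewrite -[leLHS](real_normK (num_real _)).
    rewrite ler_pXn2r ?nnegrE ?mulr_ge0 ?kor_dist_ge0 //.
    by rewrite kor_dist_sym; exact: gL.
  have al2 := sq al g1 L1 erefl; have be2 := sq be g2 L2 erefl.
  have -> : (2 * L / `|D| * kor_dist p q) ^+ 2 =
      4 * (L * kor_dist p q) ^+ 2 / D ^+ 2.
    by rewrite -[D ^+ 2](real_normK (num_real _)); field; rewrite normr_eq0.
  rewrite !expr_div_n -mulrDl ler_pM2r ?invr_gt0 //.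
  apply: (@le_trans _ _ (2 * (al ^+ 2 + be ^+ 2))); last by lra.
  (* [c] and [D] are the cosine and the sine of the angle of the normals. *)
  pose c := a1 * a2 + b1 * b2.
  have c2 : c ^+ 2 + D ^+ 2 = 1.
    by rewrite -(mulr1 1) -{1}n1 -n2 /c /D; ring.
  rewrite [leLHS](_ : _ = al ^+ 2 + be ^+ 2 - 2 * c * al * be); last first.
    transitivity ((a2 ^+ 2 + b2 ^+ 2) * al ^+ 2 + (a1 ^+ 2 + b1 ^+ 2) * be ^+ 2
      - 2 * c * al * be); first by rewrite /c; ring.
    by rewrite n1 n2 !mul1r.
  rewrite -subr_ge0.
  rewrite [leRHS](_ : _ = (al + c * be) ^+ 2 + (1 - c ^+ 2) * be ^+ 2);
    last by ring.
  rewrite (_ : 1 - c ^+ 2 = D ^+ 2); last by rewrite -c2; ring.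
  by rewrite addr_ge0 ?sqr_ge0 // mulr_ge0 ?sqr_ge0.
apply/seteqP; split=> p; rewrite /lin_graph /fixed_set /hlin /=.
  by move=> [<- <-]; split; rewrite /D; field.
move=> [-> ->]; split; rewrite /D; field; exact: D0.
Qed.

(** Two unit normals with vanishing determinant are proportional. *)
Lemma vertical_subgroup_det (a1 b1 a2 b2 : R) :
  a1 ^+ 2 + b1 ^+ 2 = 1 -> a2 ^+ 2 + b2 ^+ 2 = 1 -> a1 * b2 - a2 * b1 = 0 ->
  [set p : heis R | hlin a1 b1 p = 0] `<=` [set p | hlin a2 b2 p = 0].
Proof.
move=> n1 n2 D0 p /= p0.
have -> : hlin a2 b2 p = (a1 * a2 + b1 * b2) * hlin a1 b1 p +
    (a1 * b2 - a2 * b1) * (a1 * hy p - b1 * hx p).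
  by rewrite -[LHS]mul1r -n1 /hlin; ring.
by rewrite p0 D0 mulr0 mul0r addr0.
Qed.

Lemma translate_vcone (lambda : R) (p q : heis R) :
  translate p (vcone lambda) q <->
  lambda * ((hx q - hx p) ^+ 2 + (hy q - hy p) ^+ 2) <= `|zrel p q|.
Proof.
have E : vcone lambda (p^-1 * q)%g =
    (lambda * ((hx q - hx p) ^+ 2 + (hy q - hy p) ^+ 2) <= `|zrel p q|).
  by rewrite /vcone /= hx_mul hx_inv hy_mul hy_inv (addrC (- hx p)) (addrC (-
    hy p)).
by rewrite -E; exact: translateP.
Qed.

Lemma small_contraction (kappa : R) : 0 < kappa -> kappa <= 1 / 5 ->
  kappa ^+ 4 * (16 * 1 ^+ 2 + 1) <= 1.
Proof.
move=> k0 k5; have k4 : kappa ^+ 4 <= (1 / 5) ^+ 4.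
  by rewrite ler_pXn2r // nnegrE ltW //; lra.
have : (1 / 5) ^+ 4 = 1 / 625 :> R by field.
by rewrite expr1n; lra.
Qed.

Lemma fixed_set_curve (kappa : R) gx gy : 0 < kappa -> kappa <= 1 / 5 ->
  horizontal_contraction kappa gx gy ->
  let F := fixed_set gx gy in
  [/\ one_vertical F, no_gaps F, closed F & F !=set0].
Proof.
move=> k0 k5 gk F; split.
- move=> p q Fp Fq; rewrite -[leLHS]mul1r.
  exact: (fixed_set_vertical k0 ler01 (small_contraction k0 k5) gk).
- by apply: fixed_set_no_gaps gk => //; exact: ltW.
- exact: fixed_set_closed gk.
- by have [|q Fq _] := @fixed_set_near R kappa gx gy 1%g _ gk; [lra|exists q].
Qed.

(** From lambda r^2 <= |z| <= d^2/4 one gets r <= L d. *)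
Lemma vertical_curve_lipschitz (lambda L a b : R) (E : set (heis R)) :
  0 < L -> 1 < lambda * (4 * L ^+ 2) -> is_vertical_curve_at lambda E ->
  a ^+ 2 + b ^+ 2 = 1 -> forall p q, E p -> E q ->
  `|hlin a b p - hlin a b q| <= L * kor_dist p q.
Proof.
move=> L0 lamL vE nab p q Ep Eq; have /translate_vcone := vE p Ep q Eq.
have z := kor_dist_vertical p q; have L2 := exprn_ge0 2 (ltW L0).
set s := _ + _ => H; have s0 : 0 <= s by rewrite addr_ge0 ?sqr_ge0.
apply: (@ler_of_pow _ 1); first by rewrite mulr_ge0 ?kor_dist_ge0 // ltW.
rewrite real_normK ?num_real // exprMn; apply: (@le_trans _ _ s).
  rewrite -[leRHS]mul1r -nab -subr_ge0 /s /hlin.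
  rewrite (_ : _ - _ = (a * (hy q - hy p) - b * (hx q - hx p)) ^+ 2).
    exact: sqr_ge0.
  by ring.
have := ler_wpM2l L2 z; have := ler_wpM2l L2 H.
have := ler_wpM2r s0 (ltW lamL); lra.
Qed.

(** With kappa = 1/(5 + 4 lambda), kappa^2 (16 lambda^2 + 25) <= 1. *)
Lemma exists_contraction_factor (lambda : R) : 0 < lambda ->
  exists kappa, [/\ 0 < kappa, kappa <= 1 / 5 &
    kappa ^+ 4 * (16 * lambda ^+ 2 + 1) <= 1].
Proof.
move=> lam0; pose kappa := 1 / (5 + 4 * lambda).
have k0 : 0 < kappa by rewrite divr_gt0 //; lra.
have kD : kappa * (5 + 4 * lambda) = 1 by rewrite divfK // gt_eqF //; lra.
exists kappa; clearbody kappa.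
have k5 : kappa <= 1 / 5 by have := mulr_ge0 (ltW k0) (ltW lam0); lra.
have k2 : kappa ^+ 2 <= 1 by rewrite expr_le1 // ?ltW //; lra.
have H : kappa ^+ 2 * (16 * lambda ^+ 2 + 1) <= 1.
  have : (kappa * (5 + 4 * lambda)) ^+ 2 = 1 by rewrite kD expr1n.
  have := mulr_ge0 (sqr_ge0 kappa) (ltW lam0); have := sqr_ge0 kappa.
  have -> : (kappa * (5 + 4 * lambda)) ^+ 2 =
    kappa ^+ 2 * (16 * lambda ^+ 2 + 25) + 40 * (kappa ^+ 2 * lambda) by ring.
  by lra.
split => //; have -> : kappa ^+ 4 * (16 * lambda ^+ 2 + 1) =
  kappa ^+ 2 * (kappa ^+ 2 * (16 * lambda ^+ 2 + 1)) by ring.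
rewrite mulr_ile1 ?sqr_ge0 // mulr_ge0 ?sqr_ge0 // addr_ge0 //.
by rewrite mulr_ge0 ?sqr_ge0.
Qed.

End GraphIntersection.

Theorem theorem1p3 (R : realType) (W1 W2 : set (heis R)) :
  vertical_subgroup W1 -> vertical_subgroup W2 -> W1 <> W2 ->
  exists2 lambda0 : R, 0 < lambda0 &
  forall lambda : R, lambda0 < lambda ->
  exists L L' : R,
    [/\ 0 < L < 1, 0 < L' < 1,
      forall Gamma1 Gamma2 : set (heis R),
        entire_iLip_graph W1 L Gamma1 -> entire_iLip_graph W2 L Gamma2 ->
        [/\ is_vertical_curve_at lambda (Gamma1 `&` Gamma2),
            Gamma1 `&` Gamma2 !=set0,
            closed (Gamma1 `&` Gamma2),
            connected (Gamma1 `&` Gamma2) &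
            has_no_endpoints (Gamma1 `&` Gamma2)]
    & forall E : set (heis R), is_vertical_curve_at lambda E ->
        exists Gamma1 Gamma2 : set (heis R),
          [/\ entire_iLip_graph W1 L' Gamma1,
              entire_iLip_graph W2 L' Gamma2,
              is_vertical_curve (Gamma1 `&` Gamma2),
              E `<=` Gamma1 `&` Gamma2 &
              E !=set0 -> closed E -> connected E -> has_no_endpoints E ->
              Gamma1 `&` Gamma2 = E]].
Proof.
move=> /vertical_subgroup_unit[a1 [b1 [n1 ->]]].
move=> /vertical_subgroup_unit[a2 [b2 [n2 ->]]] W12.
pose D := a1 * b2 - a2 * b1.
have D0 : D != 0.
  apply: contra_notT W12; rewrite negbK => /eqP D0.
  apply/seteqP; split; first exact: vertical_subgroup_det.
  by apply: vertical_subgroup_det => //; rewrite -[RHS]oppr0 -D0 /D; ring.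
have nD : 0 < `|D| by rewrite normr_gt0.
have nD1 : `|D| <= 1.
  apply: (@ler_of_pow _ 1) => //; rewrite real_normK ?num_real // expr1n.
  rewrite -[leRHS]mulr1 -{1}n1 -n2 -subr_ge0.
  by rewrite (_ : _ - _ = (a1 * a2 + b1 * b2) ^+ 2) ?sqr_ge0 // /D; ring.
have kappaE (L : R) : 2 * (L * `|D| / 2) / `|D| = L.
  by field; rewrite normr_eq0.
(* The value 2 L' / |D| = 1/5 is the largest contraction factor for which the
   intersection is shown to be a curve; [lambda0] is then what makes every
   lambda-vertical curve L'-Lipschitz. *)
pose L' := 1 / 5 * `|D| / 2.
have L'0 : 0 < L' by rewrite /L'; lra.
exists (1 / (4 * L' ^+ 2)); first by rewrite divr_gt0 // mulr_gt0 // exprn_gt0.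
move=> lambda; rewrite ltr_pdivrMr ?mulr_gt0 ?exprn_gt0 // => lamL'.
have lam0 : 0 < lambda.
  rewrite ltNge; apply/negP => lam0.
  have c0 : 0 <= 4 * L' ^+ 2 by rewrite mulr_ge0 ?sqr_ge0.
  by have := mulr_le0_ge0 lam0 c0; lra.
have [kappa [k0 k5 kl]] := exists_contraction_factor lam0.
pose L := kappa * `|D| / 2.
have L0 : 0 < L by rewrite /L !mulr_gt0 // invr_gt0.
have L1 : L < 1.
  have := ler_pM (ltW k0) (ltW nD) k5 nD1; rewrite /L; lra.
have L'1 : L' < 1 by rewrite /L'; lra.
exists L, L'; split; rewrite ?L0 ?L'0 //.
- have iL : 0 <= L < 1 by rewrite ltW.
  move=> Gamma1 Gamma2 /(entire_graph_lin n1 iL)[g1 g1L ->].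
  move=> /(entire_graph_lin n2 iL)[g2 g2L ->].
  have [gx [gy []]] := lin_graph_intersection n1 n2 D0 (ltW L0) g1L g2L.
  rewrite kappaE => gk ->.
  have [vF gF clF F0] := fixed_set_curve k0 k5 gk.
  split => //.
  + move=> p Fp q Fq; apply/translate_vcone.
    exact: (fixed_set_vertical k0 (ltW lam0) kl gk).
  + exact: no_gaps_connected.
  + exact: no_gaps_has_no_endpoints.
move=> E vE.
(* McShane's extension starts from a nonempty set; the origin replaces an empty
   curve. *)
pose E1 := if pselect (E !=set0) then E else [set 1%g].
have [E10 EE1 vE1] : [/\ E1 !=set0, E `<=` E1 & is_vertical_curve_at lambda E1].
  rewrite /E1; case: pselect => E0; first by split.
  split; first by exists 1%g.
    by move=> p Ep; case: E0; exists p.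
  move=> _ -> _ ->; apply/translate_vcone.
  by rewrite zrel_refl normr0 !subrr expr0n /= addr0 mulr0.
have E1L a b := @vertical_curve_lipschitz R lambda L' a b E1 L'0 lamL' vE1.
have [g1 g1L Eg1] := mcshane_extension (ltW L'0) E10 (E1L _ _ n1).
have [g2 g2L Eg2] := mcshane_extension (ltW L'0) E10 (E1L _ _ n2).
have EG : E `<=` lin_graph a1 b1 g1 `&` lin_graph a2 b2 g2.
  by move=> p /EE1 Ep; split; [exact: Eg1|exact: Eg2].
exists (lin_graph a1 b1 g1), (lin_graph a2 b2 g2).
have [gx [gy []]] := lin_graph_intersection n1 n2 D0 (ltW L'0) g1L g2L.
rewrite kappaE => gk FE; have fifth : 0 < 1 / 5 :> R by lra.
have [vF gF clF F0] := fixed_set_curve fifth (lexx _) gk.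
split; [exact: lin_graph_entire|exact: lin_graph_entire| |exact: EG|].
- exists 1 => //; rewrite FE => p Fp q Fq; apply/translate_vcone.
  by rewrite mul1r; exact: vF.
move=> E0 clE cE nE; apply/seteqP; split => //; rewrite FE in EG *.
exact: no_endpoints_maximal.
Qed.
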